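(* Let $K\subset H$ be an extension of Hopf algebras over a field $\Bbbk$. Assume that $H$ is finite-dimensional, or that $H$ is pointed, or, more generally, that $K\subset H$ is an extension of right integral type. If $K\subset H$ is a Frobenius extension, then the induction functor $\mathrm{Ind}_K^H\colon K\text{-}\mathbf{Mod}\to H\text{-}\mathbf{Mod}$ is a Frobenius monoidal functor.
   Context: All Hopf algebras are over $\Bbbk$ and have invertible antipode; $\Delta(h)=h_{(1)}\otimes h_{(2)}$ is the coproduct, $\varepsilon$ the counit. $H\text{-}\mathbf{Mod}$ is the monoidal category of left $H$-modules. An extension $K\subset H$ is an inclusion of Hopf algebras. $\mathrm{Ind}_K^H(V)=H\otimes_K V$. A Hopf algebra is pointed if every simple subcoalgebra is one-dimensional. Frobenius extension: $K\subset H$ is a Frobenius extension if $H$ is finitely generated projective over $K$ and there is a Frobenius morphism, i.e. a $K$-$K$-bimodule map $\mathrm{tr}\colon H\to K$ such that $H\to \mathrm{Hom}_K(H,K)$ (left $K$-linear maps), $h\mapsto \mathrm{tr}((-)h)$, is bijective (equivalently, induction and coinduction $\mathrm{Hom}_K(H,-)$ are isomorphic functors). Given $\mathrm{tr}$ there are $h_1,\dots,h_n,\delta_1,\dots,\delta_n\in H$ with $h=\sum_i\mathrm{tr}(h\delta_i)h_i=\sum_i\delta_i\,\mathrm{tr}(h_ih)$ for all $h\in H$. Then $F=\mathrm{Ind}_K^H$ carries the lax and oplax monoidal structures $\mathrm{lax}_{V,U}\colon F(V)\otimes F(U)\to F(V\otimes U)$, $(h\otimes_K v)\otimes(g\otimes_K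 u)\mapsto\sum_i\delta_i\otimes_K(\mathrm{tr}((h_i)_{(1)}h)v\otimes\mathrm{tr}((h_i)_{(2)}g)u)$; $\mathrm{lax}_0\colon\Bbbk\to F(\Bbbk)$, $1\mapsto\sum_i\delta_i\otimes_K\varepsilon(h_i)$; $\mathrm{oplax}_{V,U}\colon F(V\otimes U)\to F(V)\otimes F(U)$, $h\otimes_K(v\otimes u)\mapsto(h_{(1)}\otimes_K v)\otimes(h_{(2)}\otimes_K u)$; $\mathrm{oplax}_0\colon F(\Bbbk)\to\Bbbk$, $h\otimes_K1\mapsto\varepsilon(h)$. Frobenius monoidal functor: a functor $F$ between monoidal categories with a lax and an oplax monoidal structure such that for all objects $X,Y,Z$: $(\mathrm{lax}_{X,Y}\otimes\mathrm{id})(\mathrm{id}\otimes\mathrm{oplax}_{Y,Z})=\mathrm{oplax}_{X\otimes Y,Z}\,\mathrm{lax}_{X,Y\otimes Z}$ and $(\mathrm{id}\otimes\mathrm{lax}_{Y,Z})(\mathrm{oplax}_{X,Y}\otimes\mathrm{id})=\mathrm{oplax}_{X,Y\otimes Z}\,\mathrm{lax}_{X\otimes Y,Z}$. The assertion that $\mathrm{Ind}_K^H$ is Frobenius monoidal refers to the structures above for a suitable Frobenius morphism $\mathrm{tr}$. Right integral type: Put $K^+=\ker\varepsilon_K$, $\overline H=H/HK^+$, $\overline h=h+HK^+$. $\overline H^*=\mathrm{Hom}_\Bbbk(\overline H,\Bbbk)$ is an algebra under convolution $(\mu*\nu)(\overline h)=\mu(\overline{h_{(1)}})\nu(\overline{h_{(2)}})$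 with augmentation $\mu\mapsto\mu(\overline1)$. A right integral of an algebra $A$ with augmentation $\varepsilon$ is $\Lambda\in A$ with $\Lambda x=\Lambda\varepsilon(x)$ for all $x$. The extension $K\subset H$ is of right integral type if there exist (a) a non-zero right integral $\lambda$ of $\overline H^*$; (b) $\Lambda\in H$ with $\lambda(\overline{\Lambda h})=\varepsilon(h)$ for all $h\in H$; (c) an algebra map $\chi\colon K\to\Bbbk$ with $\lambda(\overline{kh})=\chi(k)\lambda(\overline h)$ for all $k\in K,h\in H$. *)

(* Defs.v *)
From HB Require Import structures.
From mathcomp Require Import all_boot all_algebra.
From mathcomp Require Import boolp.

Set Implicit Arguments.
Unset Strict Implicit.
Unset Printing Implicit Defensive.

Import GRing.Theory.
Local Open Scope ring_scope.
Local Open Scope quotient_scope.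

Section Linear.
Variables (R : pzRingType) (U V : lmodType R).

Definition mklin (f : U -> V) (f_lin : linear f) : {linear U -> V} :=
  HB.pack f (GRing.isLinear.Build R U V *:%R f f_lin).

Lemma linear_ext (f g : {linear U -> V}) : f =1 g -> f = g.
Proof.
case: f g => [f [[fa] [fs]]] [g [[ga] [gs]]] /= /funext fg.
subst g; congr (GRing.Linear.Pack (GRing.Linear.Class _ _)); congr (_ _).
- exact: Prop_irrelevance.
- exact: Prop_irrelevance.
Qed.
End Linear.

(* Balanced tensor products

    [tens ra la] is the abelian group M ⊗_R N, where [ra] is the right action of
    R on M and [la] its left action on N.  Its elements are formal sums of pairs,
    two of them being identified when every balanced map takes the same value on
    both; it is generated by the [tens_pure m n] and has the universal property
    [tens_universal].  [tens_lift f t], written [\sw_(m, n <- t) f m n], is the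
    value at [t] of the additive map induced by [f]; it is meaningful only for
    balanced [f].  With [t := comul h] it is Sweedler's summation. *)

Section Tensor.
Variables (R : Type) (M N : zmodType) (ra : M -> R -> M) (la : R -> N -> N).
Implicit Types A B : zmodType.

Record balanced (A : zmodType) (f : M -> N -> A) : Prop := Balanced {
  balDl : forall n, {morph f^~ n : x y / x + y};
  balDr : forall m, {morph f m : x y / x + y};
  balZ : forall m r n, f (ra m r) n = f m (la r n)
}.

Lemma bal0l A (f : M -> N -> A) : balanced f -> forall n, f 0 n = 0.
Proof. by move=> h n; apply: (addrI (f 0 n)); rewrite -(balDl h) !addr0. Qed.
Lemma balNl A (f : M -> N -> A) : balanced f -> forall m n, f (- m) n = - f m n.
Proof.
move=> h m n; apply: (addrI (f m n)).
by rewrite -(balDl h) !subrr (bal0l h).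
Qed.

Definition formal_sum (A : zmodType) (f : M -> N -> A) (s : seq (M * N)) : A :=
  \sum_(p <- s) f p.1 p.2.

Definition tens_eq : rel (seq (M * N)) := fun s t =>
  `[< forall (A : zmodType) (f : M -> N -> A),
        balanced f -> formal_sum f s = formal_sum f t >].

Lemma tens_eqP s t : reflect (forall (A : zmodType) (f : M -> N -> A),
  balanced f -> formal_sum f s = formal_sum f t) (tens_eq s t).
Proof. exact: asboolP. Qed.

Lemma tens_eq_equiv : equiv_class_of tens_eq.
Proof.
split=> [s|s t|t s u].
- exact/tens_eqP.
- by apply/tens_eqP/tens_eqP => h A f hf; rewrite h.
- by move=> /tens_eqP h1 /tens_eqP h2; apply/tens_eqP => A f hf; rewrite h1 ?h2.
Qed.
Canonical tens_eq_equivRel := EquivRelPack tens_eq_equiv.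
Canonical tens_eq_encModRel := defaultEncModRel tens_eq.

Definition tens : Type := {eq_quot tens_eq}.
HB.instance Definition _ := Choice.on tens.
HB.instance Definition _ := EqQuotient.on tens.

Definition tens_lift (A : zmodType) (f : M -> N -> A) (t : tens) : A :=
  formal_sum f (repr t).

Lemma tens_lift_pi A (f : M -> N -> A) s :
  balanced f -> tens_lift f (\pi_tens s) = formal_sum f s.
Proof.
move=> hf; rewrite /tens_lift.
have /eqmodP/tens_eqP h : repr (\pi_tens s) = s %[mod tens] by rewrite reprK.
exact: h.
Qed.

Lemma tens_pi_eq s t : (forall (A : zmodType) (f : M -> N -> A),
  balanced f -> formal_sum f s = formal_sum f t) -> \pi_tens s = \pi_tens t.
Proof. by move=> h; apply/eqmodP/tens_eqP. Qed.

Lemma tens_sep (x y : tens) : (forall (A : zmodType) (f : M -> N -> A),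
  balanced f -> tens_lift f x = tens_lift f y) -> x = y.
Proof.
rewrite -[x]reprK -[y]reprK => h; apply: tens_pi_eq => A f hf.
by rewrite -!tens_lift_pi ?h.
Qed.

Definition tens_zero : tens := \pi_tens [::].
Definition tens_add (x y : tens) : tens := \pi_tens (repr x ++ repr y).
Definition tens_opp (x : tens) : tens :=
  \pi_tens [seq (- p.1, p.2) | p <- repr x].

Lemma lift_zero A f : balanced f -> @tens_lift A f tens_zero = 0.
Proof. by move=> hf; rewrite tens_lift_pi // /formal_sum big_nil. Qed.
Lemma lift_add A f : balanced f ->
  {morph @tens_lift A f : x y / tens_add x y >-> x + y}.
Proof. by move=> hf x y; rewrite tens_lift_pi // /formal_sum big_cat. Qed.
Lemma lift_opp A f : balanced f ->
  {morph @tens_lift A f : x / tens_opp x >-> - x}.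
Proof.
move=> hf x; rewrite tens_lift_pi // /formal_sum big_map -sumrN.
by apply: eq_bigr => p _; rewrite (balNl hf).
Qed.

Lemma tens_addA : associative tens_add.
Proof. by move=> x y z; apply: tens_sep => A f hf; rewrite !lift_add ?addrA. Qed.
Lemma tens_addC : commutative tens_add.
Proof. by move=> x y; apply: tens_sep => A f hf; rewrite !lift_add // addrC. Qed.
Lemma tens_add0 : left_id tens_zero tens_add.
Proof. by move=> x; apply: tens_sep => A f hf; rewrite lift_add // lift_zero ?add0r. Qed.
Lemma tens_addN : left_inverse tens_zero tens_opp tens_add.
Proof.
by move=> x; apply: tens_sep => A f hf; rewrite lift_add // lift_opp // lift_zero ?addNr.
Qed.
HB.instance Definition _ :=
  GRing.isZmodule.Build tens tens_addA tens_addC tens_add0 tens_addN.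

Definition tens_pure (m : M) (n : N) : tens := \pi_tens [:: (m, n)].

Lemma tens_lift_pure A (f : M -> N -> A) m n :
  balanced f -> tens_lift f (tens_pure m n) = f m n.
Proof. by move=> hf; rewrite tens_lift_pi // /formal_sum big_seq1. Qed.

Lemma tens_liftD A (f : M -> N -> A) :
  balanced f -> {morph tens_lift f : x y / x + y}.
Proof. exact: lift_add. Qed.

Lemma tens_pure_balanced : balanced tens_pure.
Proof.
by split=> [n m m'|m n n'|m r n]; apply: tens_sep => A f hf;
  rewrite ?tens_liftD // ?tens_lift_pure // ?(balDl hf, balDr hf, balZ hf).
Qed.

Lemma tens_pi_sum s : \pi_tens s = \sum_(p <- s) tens_pure p.1 p.2.
Proof.
elim: s => [|p s IH]; first by rewrite big_nil.
rewrite big_cons -IH; apply: tens_sep => A f hf.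
by rewrite tens_liftD // tens_lift_pure // !tens_lift_pi // /formal_sum big_cons.
Qed.

Lemma tens_ext A (F G : tens -> A) :
  {morph F : x y / x + y} -> {morph G : x y / x + y} ->
  (forall m n, F (tens_pure m n) = G (tens_pure m n)) -> F =1 G.
Proof.
move=> FD GD FG x; rewrite -[x]reprK tens_pi_sum.
have H0 (H : tens -> A) : {morph H : x y / x + y} -> H 0 = 0.
  by move=> HD; apply: (addrI (H 0)); rewrite -HD !addr0.
elim: (repr x) => [|p s IH]; first by rewrite big_nil !H0.
by rewrite big_cons FD GD IH FG.
Qed.

Lemma tens_universal (A : zmodType) (f : M -> N -> A) : balanced f ->
  exists F : tens -> A, [/\ {morph F : x y / x + y},
    forall m n, F (tens_pure m n) = f m n &
    forall G : tens -> A, {morph G : x y / x + y} ->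
      (forall m n, G (tens_pure m n) = f m n) -> G =1 F].
Proof.
move=> hf; exists (tens_lift f); split=> [|m n|G GD Gf]; first exact: tens_liftD.
- exact: tens_lift_pure.
- by apply: tens_ext => // [|m n]; [exact: tens_liftD | rewrite Gf tens_lift_pure].
Qed.

Lemma eq_tens_lift A (f g : M -> N -> A) t : f =2 g -> tens_lift f t = tens_lift g t.
Proof. by move=> fg; apply: eq_bigr => p _; rewrite fg. Qed.

Lemma tens_lift_fD A (f g : M -> N -> A) t :
  tens_lift (fun m n => f m n + g m n) t = tens_lift f t + tens_lift g t.
Proof. exact: big_split. Qed.

Lemma tens_lift_comp A B (h : A -> B) (f : M -> N -> A) t :
  {morph h : x y / x + y} -> h (tens_lift f t) = tens_lift (fun m n => h (f m n)) t.
Proof.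
move=> hD; apply: (big_morph h hD).
by apply: (addrI (h 0)); rewrite -hD !addr0.
Qed.

Lemma tens_lift_id (t : tens) : tens_lift tens_pure t = t.
Proof. by rewrite /tens_lift /formal_sum -tens_pi_sum reprK. Qed.
End Tensor.

Lemma tens_lift_exchange (R R' : Type) (M N M' N' A : zmodType)
  (ra : M -> R -> M) (la : R -> N -> N) (ra' : M' -> R' -> M') (la' : R' -> N' -> N')
  (f : M -> N -> M' -> N' -> A) (t : tens ra la) (u : tens ra' la') :
  tens_lift (fun m n => tens_lift (f m n) u) t
  = tens_lift (fun m' n' => tens_lift (fun m n => f m n m' n') t) u.
Proof. exact: exchange_big. Qed.

Notation "\sw_ ( a , b <- t ) E" := (tens_lift (fun a b => E) t)
  (at level 41, a name, b name, t at level 50, E at level 41,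
   format "\sw_ ( a ,  b  <-  t )  E") : ring_scope.

Section VTensor.
Variables (k : comPzRingType) (V W : lmodType k).

Definition vtens : Type :=
  tens (fun (v : V) (c : k) => c *: v) (fun (c : k) (w : W) => c *: w).
HB.instance Definition _ := GRing.Zmodule.on vtens.

Definition vpure (v : V) (w : W) : vtens := tens_pure _ _ v w.

Definition vscale (c : k) (t : vtens) : vtens := \sw_(v, w <- t) vpure (c *: v) w.

Lemma vpure_balanced : balanced (fun (v : V) (c : k) => c *: v)
  (fun (c : k) (w : W) => c *: w) vpure.
Proof. exact: tens_pure_balanced. Qed.

Lemma vscale_balanced c : balanced (fun (v : V) (c : k) => c *: v)
  (fun (c : k) (w : W) => c *: w) (fun v w => vpure (c *: v) w).
Proof.
split=> [w v v'|v w w'|v d w] /=.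
- by rewrite scalerDr (balDl vpure_balanced).
- by rewrite (balDr vpure_balanced).
- by rewrite -(balZ vpure_balanced) !scalerA mulrC.
Qed.

Lemma vscaleD c : {morph vscale c : x y / x + y}.
Proof. exact: tens_liftD (vscale_balanced c). Qed.
Lemma vscale_pure c v w : vscale c (vpure v w) = vpure (c *: v) w.
Proof. exact: tens_lift_pure (vscale_balanced c). Qed.

Lemma vscaleA a b t : vscale a (vscale b t) = vscale (a * b) t.
Proof.
move: t; apply: tens_ext => [x y|x y|v w]; rewrite ?vscaleD //.
by rewrite !vscale_pure scalerA.
Qed.
Lemma vscale1 : left_id 1 vscale.
Proof.
apply: tens_ext => [x y|x y|v w] //; first by rewrite vscaleD.
by rewrite vscale_pure scale1r.
Qed.
Lemma vscaleDr : right_distributive vscale +%R.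
Proof. by move=> c x y; rewrite vscaleD. Qed.
Lemma vscaleDl t : {morph vscale^~ t : a b / a + b}.
Proof.
move=> a b; move: t; apply: tens_ext => [x y|x y|v w] /=; rewrite ?vscaleD //.
  by rewrite addrACA.
by rewrite !vscale_pure scalerDl (balDl vpure_balanced).
Qed.
HB.instance Definition _ := GRing.Zmodule_isLmodule.Build k vtens
  vscaleA vscale1 vscaleDr vscaleDl.
Lemma vtens_scale_pure (c : k) v w : c *: vpure v w = vpure (c *: v) w.
Proof. exact: vscale_pure. Qed.
End VTensor.

Section TensMul.
Variables (k : comPzRingType) (A : algType k).
Definition vtens_mul (s t : vtens A A) : vtens A A :=
  \sw_(a, b <- s) \sw_(c, d <- t) vpure (a * c) (b * d).
End TensMul.

(* The invertibility of the antipode is part of the definition. *)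
HB.mixin Record isHopfAlgebra (k : fieldType) H of GRing.Algebra k H := {
  comul : {linear H -> vtens H H};
  counit : {lrmorphism H -> k | *%R};
  antipode : {linear H -> H};
  comulA : forall h : H,
    \sw_(a, b <- comul h) \sw_(c, d <- comul b) vpure a (vpure c d) =
    \sw_(a, b <- comul h) \sw_(c, d <- comul a) vpure c (vpure d b)
      :> vtens H (vtens H H);
  counitl : forall h : H, \sw_(a, b <- comul h) (counit a *: b) = h;
  counitr : forall h : H, \sw_(a, b <- comul h) (counit b *: a) = h;
  comul1 : comul 1 = vpure 1 1;
  comulM : forall g h : H, comul (g * h) = vtens_mul (comul g) (comul h);
  antipodel : forall h : H, \sw_(a, b <- comul h) (antipode a * b) = (counit h)%:A;
  antipoder : forall h : H, \sw_(a, b <- comul h) (a * antipode b) = (counit h)%:A;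
  antipode_bij : bijective antipode
}.

#[short(type="hopfAlgType")]
HB.structure Definition HopfAlgebra (k : fieldType) :=
  {H of GRing.Algebra k H & isHopfAlgebra k H}.

Section ModTensor.
Variables (k : fieldType) (A : hopfAlgType k).

(* A left A-module V is a k-vector space through the unit map c |-> c%:A of A;
   [sratk] and [slatk] are this action of k, written on either side. *)
Definition sratk (V : lmodType A) (v : V) (c : k) : V := c%:A *: v.
Definition slatk (V : lmodType A) (c : k) (v : V) : V := c%:A *: v.

Lemma scalA_comm (c : k) (a : A) : a * c%:A = c%:A * a.
Proof. by rewrite -scalerAr mulr1 -scalerAl mul1r. Qed.

Lemma scalA_M (c d : k) : c%:A * d%:A = (c * d)%:A :> A.
Proof. by rewrite -scalerAl mul1r scalerA. Qed.

Section Obj.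
Variables V U : lmodType A.
Definition mtens : Type := tens (@sratk V) (@slatk U).
HB.instance Definition _ := GRing.Zmodule.on mtens.
Definition mpure (v : V) (u : U) : mtens := tens_pure _ _ v u.

Lemma mpure_balanced : balanced (@sratk V) (@slatk U) mpure.
Proof. exact: tens_pure_balanced. Qed.

Lemma mpureDl v v' u : mpure (v + v') u = mpure v u + mpure v' u.
Proof. exact: balDl mpure_balanced _ _ _. Qed.
Lemma mpureDr v u u' : mpure v (u + u') = mpure v u + mpure v u'.
Proof. exact: balDr mpure_balanced _ _ _. Qed.
Lemma mpureZ (c : k) v u : mpure (c%:A *: v) u = mpure v (c%:A *: u).
Proof. exact: balZ mpure_balanced _ _ _. Qed.

Definition mact2 (a b : A) (t : mtens) : mtens := \sw_(v, u <- t) mpure (a *: v) (b *: u).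

Lemma mact2_balanced a b :
  balanced (@sratk V) (@slatk U) (fun v u => mpure (a *: v) (b *: u)).
Proof.
split=> [u v v'|v u u'|v c u] /=.
- by rewrite scalerDr mpureDl.
- by rewrite scalerDr mpureDr.
- by rewrite /sratk /slatk !scalerA !scalA_comm -!scalerA mpureZ.
Qed.
Lemma mact2D a b : {morph mact2 a b : x y / x + y}.
Proof. exact: tens_liftD (mact2_balanced a b). Qed.
Lemma mact2_pure a b v u : mact2 a b (mpure v u) = mpure (a *: v) (b *: u).
Proof. exact: tens_lift_pure (mact2_balanced a b). Qed.

Lemma mact2_act_balanced t : balanced (fun (a : A) (c : k) => c *: a)
  (fun (c : k) (a : A) => c *: a) (fun a b => mact2 a b t).
Proof.
split=> [b a a'|a b b'|a c b] /=; rewrite /mact2.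
- by rewrite -tens_lift_fD; apply: eq_tens_lift => v u; rewrite scalerDl mpureDl.
- by rewrite -tens_lift_fD; apply: eq_tens_lift => v u; rewrite scalerDl mpureDr.
- apply: eq_tens_lift => v u.
  by rewrite -(mulr_algl c a) -(mulr_algl c b) -!scalerA mpureZ.
Qed.

(* The diagonal action: x (v ⊗ u) = x_(1) v ⊗ x_(2) u, see [mtens_scale_pure]. *)
Definition mscale (x : A) (t : mtens) : mtens := \sw_(a, b <- comul x) mact2 a b t.

Lemma mscaleDr : right_distributive mscale +%R.
Proof.
move=> x s t; rewrite /mscale -tens_lift_fD.
by apply: eq_tens_lift => a b; rewrite mact2D.
Qed.
Lemma mscaleDl t : {morph mscale^~ t : x y / x + y}.
Proof.
by move=> x y; rewrite /mscale linearD (tens_liftD (mact2_act_balanced t)).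
Qed.
Lemma mscale_pure x v u :
  mscale x (mpure v u) = \sw_(a, b <- comul x) mpure (a *: v) (b *: u).
Proof. by apply: eq_tens_lift => a b; rewrite mact2_pure. Qed.

Lemma act_pure_balanced v u : balanced (fun (a : A) (c : k) => c *: a)
  (fun (c : k) (a : A) => c *: a) (fun a b => mpure (a *: v) (b *: u)).
Proof.
split=> [b a a'|a b b'|a c b] /=.
- by rewrite scalerDl mpureDl.
- by rewrite scalerDl mpureDr.
- by rewrite -(mulr_algl c a) -(mulr_algl c b) -!scalerA mpureZ.
Qed.

Lemma mscale1 : left_id 1 mscale.
Proof.
apply: tens_ext => [x y|x y|v u] //; first by rewrite mscaleDr.
rewrite mscale_pure comul1.
have hb := act_pure_balanced v u.
by rewrite [LHS](tens_lift_pure _ _ hb) !scale1r.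
Qed.

Lemma mscaleA x y t : mscale x (mscale y t) = mscale (x * y) t.
Proof.
move: t; apply: tens_ext => [s t|s t|v u]; rewrite ?mscaleDr //.
rewrite mscale_pure (tens_lift_comp _ _ (mscaleDr x)) /mscale comulM /vtens_mul.
have hb := mact2_act_balanced (mpure v u).
rewrite (tens_lift_comp _ _ (tens_liftD hb)) tens_lift_exchange.
apply: eq_tens_lift => a b; rewrite (tens_lift_comp _ _ (tens_liftD hb)).
apply: eq_tens_lift => c d; rewrite [RHS](tens_lift_pure _ _ hb).
by rewrite !mact2_pure !scalerA.
Qed.

HB.instance Definition _ := GRing.Zmodule_isLmodule.Build A mtens
  mscaleA mscale1 mscaleDr mscaleDl.

Lemma mtens_scale_pure (x : A) v u :
  x *: mpure v u = \sw_(a, b <- comul x) mpure (a *: v) (b *: u).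
Proof. exact: mscale_pure. Qed.

Lemma mtens_scalk (c : k) v u : c%:A *: mpure v u = mpure (c%:A *: v) u.
Proof.
rewrite mtens_scale_pure linearZ /= comul1 vtens_scale_pure.
by rewrite (tens_lift_pure _ _ (act_pure_balanced v u)) scale1r.
Qed.

Lemma mtens_ext (B : zmodType) (F G : mtens -> B) :
  {morph F : x y / x + y} -> {morph G : x y / x + y} ->
  (forall v u, F (mpure v u) = G (mpure v u)) -> F =1 G.
Proof. exact: tens_ext. Qed.

Lemma mtens_linear (W : lmodType A) (F : mtens -> W) :
  {morph F : x y / x + y} ->
  (forall x v u, F (x *: mpure v u) = x *: F (mpure v u)) -> linear F.
Proof.
move=> FD FZ x s t; rewrite FD; congr (_ + _).
move: s; apply: mtens_ext => [s s'|s s'|v u]; first by rewrite scalerDr FD.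
- by rewrite FD scalerDr.
- exact: FZ.
Qed.

End Obj.
End ModTensor.
Arguments mpure {k A V U} v u.
Arguments sratk {k A V} v c.
Arguments slatk {k A V} c v.

(* The ground field, with A acting through the counit. *)
Definition munit (k : fieldType) (A : hopfAlgType k) : Type := k.

Section Unit.
Variables (k : fieldType) (A : hopfAlgType k).
HB.instance Definition _ := GRing.Zmodule.copy (munit A) k.
Definition munit_scale (a : A) (c : munit A) : munit A := counit a * (c : k).
Lemma munit_scaleA a b c : munit_scale a (munit_scale b c) = munit_scale (a * b) c.
Proof. by rewrite /munit_scale rmorphM mulrA. Qed.
Lemma munit_scale1 : left_id 1 munit_scale.
Proof. by move=> c; rewrite /munit_scale rmorph1 mul1r. Qed.
Lemma munit_scaleDr : right_distributive munit_scale +%R.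
Proof. by move=> a c d; rewrite /munit_scale mulrDr. Qed.
Lemma munit_scaleDl c : {morph munit_scale^~ c : a b / a + b}.
Proof. by move=> a b; rewrite /munit_scale rmorphD mulrDl. Qed.
HB.instance Definition _ := GRing.Zmodule_isLmodule.Build A (munit A)
  munit_scaleA munit_scale1 munit_scaleDr munit_scaleDl.
Lemma munit_scaleE (a : A) (c : munit A) : a *: c = (counit a * (c : k) : k).
Proof. by []. Qed.
End Unit.

Section ModMaps.
Variables (k : fieldType) (A : hopfAlgType k).
Implicit Types V U W : lmodType A.

Section Map.
Variables (V V' U U' : lmodType A) (f : {linear V -> V'}) (g : {linear U -> U'}).
Lemma mmap_balanced :
  balanced (@sratk k A V) (@slatk k A U) (fun v u => mpure (f v) (g u)).
Proof.
split=> [u v v'|v u u'|v c u] /=.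
- by rewrite linearD mpureDl.
- by rewrite linearD mpureDr.
- by rewrite /sratk /slatk !linearZ mpureZ.
Qed.
Definition mmap_fun (t : mtens V U) : mtens V' U' := \sw_(v, u <- t) mpure (f v) (g u).
Lemma mmap_linear : linear mmap_fun.
Proof.
apply: mtens_linear => [|x v u]; first exact: tens_liftD mmap_balanced.
rewrite /mmap_fun mtens_scale_pure (tens_lift_comp _ _ (tens_liftD mmap_balanced)).
rewrite [tens_lift _ (mpure v u)](tens_lift_pure _ _ mmap_balanced).
rewrite mtens_scale_pure; apply: eq_tens_lift => a b.
by rewrite [LHS](tens_lift_pure _ _ mmap_balanced) !linearZ.
Qed.
Definition mmap : {linear mtens V U -> mtens V' U'} := mklin mmap_linear.
Lemma mmap_pure v u : mmap (mpure v u) = mpure (f v) (g u).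
Proof. exact: tens_lift_pure mmap_balanced. Qed.
End Map.

Section Assoc.
Variables V U W : lmodType A.

Lemma assoc_bal1 (w : W) : balanced (@sratk k A V) (@slatk k A U)
  (fun v u => mpure v (mpure u w)).
Proof.
split=> [u v v'|v u u'|v c u] /=; rewrite ?mpureDl ?mpureDr //.
by rewrite /sratk /slatk mpureZ mtens_scalk.
Qed.
Lemma assoc_bal : balanced (@sratk k A (mtens V U)) (@slatk k A W)
  (fun s w => \sw_(v, u <- s) mpure v (mpure u w)).
Proof.
split=> [w s s'|s w w'|s c w] /=.
- exact: tens_liftD (assoc_bal1 w) _ _.
- by rewrite -tens_lift_fD; apply: eq_tens_lift => v u; rewrite !mpureDr.
- move: s; apply: mtens_ext => [s s'|s s'|v u].
  + by rewrite /sratk scalerDr (tens_liftD (assoc_bal1 w)).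
  + exact: tens_liftD (assoc_bal1 _) _ _.
  + rewrite /sratk mtens_scalk !(tens_lift_pure _ _ (assoc_bal1 _)).
    by rewrite mpureZ mtens_scalk mpureZ.
Qed.
Definition massoc_fun (t : mtens (mtens V U) W) : mtens V (mtens U W) :=
  \sw_(s, w <- t) \sw_(v, u <- s) mpure v (mpure u w).
Lemma massoc_funD : {morph massoc_fun : x y / x + y}.
Proof. exact: tens_liftD assoc_bal. Qed.
Lemma massoc_fun_pure v u w :
  massoc_fun (mpure (mpure v u) w) = mpure v (mpure u w).
Proof.
rewrite /massoc_fun [LHS](tens_lift_pure _ _ assoc_bal).
exact: tens_lift_pure (assoc_bal1 w).
Qed.

Lemma comul_assoc_act (x : A) (v : V) (u : U) (w : W) :
  \sw_(a, b <- comul x) \sw_(c, d <- comul b) mpure (a *: v) (mpure (c *: u) (d *: w)) =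
  \sw_(a, b <- comul x) \sw_(c, d <- comul a) mpure (c *: v) (mpure (d *: u) (b *: w)).
Proof.
pose g (a : A) (t : vtens A A) : mtens V (mtens U W) :=
  \sw_(c, d <- t) mpure (a *: v) (mpure (c *: u) (d *: w)).
have hb1 a : balanced (fun (a : A) (c : k) => c *: a) (fun (c : k) (a : A) => c *: a)
    (fun c d => mpure (a *: v) (mpure (c *: u) (d *: w))).
  have h := act_pure_balanced u w.
  split=> [b c c'|c b b'|c e b] /=; rewrite -1?mpureDr; congr (mpure _ _).
  - exact: (balDl h b c c').
  - exact: (balDr h c b b').
  - exact: (balZ h c e b).
have gb : balanced (fun (a : A) (c : k) => c *: a)
    (fun (c : k) (t : vtens A A) => c *: t) g.
  split=> [t a a'|a t t'|a c t] /=.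
  - by rewrite /g -tens_lift_fD; apply: eq_tens_lift => c d; rewrite scalerDl mpureDl.
  - exact: tens_liftD (hb1 a) _ _.
  - move: t; apply: tens_ext => [s t|s t|b d].
    + exact: tens_liftD (hb1 _) _ _.
    + by rewrite scalerDr; exact: tens_liftD (hb1 _) _ _.
    + rewrite [LHS](tens_lift_pure _ _ (hb1 _)) vtens_scale_pure.
      rewrite [RHS](tens_lift_pure _ _ (hb1 _)).
      by rewrite -(mulr_algl c a) -(mulr_algl c b) -!scalerA mpureZ mtens_scalk.
have gD := tens_liftD gb.
have /(congr1 (tens_lift g)) := comulA x.
rewrite !(tens_lift_comp _ _ gD) => e.
transitivity (\sw_(a, b <- comul x) tens_lift g (\sw_(c, d <- comul b) vpure a (vpure c d))).
  apply: eq_tens_lift => a b; rewrite (tens_lift_comp _ _ gD).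
  apply: eq_tens_lift => c d; rewrite [RHS](tens_lift_pure _ _ gb).
  by rewrite /g [RHS](tens_lift_pure _ _ (hb1 _)).
rewrite e; apply: eq_tens_lift => a b; rewrite (tens_lift_comp _ _ gD).
apply: eq_tens_lift => c d; rewrite [LHS](tens_lift_pure _ _ gb).
by rewrite /g [LHS](tens_lift_pure _ _ (hb1 _)).
Qed.

Lemma massoc_linear : linear massoc_fun.
Proof.
apply: mtens_linear; first exact: massoc_funD.
move=> x s w; move: s; apply: mtens_ext => [s t|s t|v u].
- by rewrite mpureDl scalerDr massoc_funD.
- by rewrite mpureDl massoc_funD scalerDr.
rewrite massoc_fun_pure !mtens_scale_pure (tens_lift_comp _ _ massoc_funD).
transitivity (\sw_(a, b <- comul x) \sw_(c, d <- comul a)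
    mpure (c *: v) (mpure (d *: u) (b *: w))); last first.
  rewrite -comul_assoc_act; apply: eq_tens_lift => a b.
  rewrite mtens_scale_pure [RHS](tens_lift_comp (h := mpure (a *: v))) //.
  exact: mpureDr.
apply: eq_tens_lift => a b; rewrite mtens_scale_pure.
rewrite (tens_lift_comp (h := fun s => mpure s (b *: w))); last first.
  by move=> ? ?; rewrite mpureDl.
rewrite (tens_lift_comp _ _ massoc_funD); apply: eq_tens_lift => c d.
by rewrite massoc_fun_pure.
Qed.
Definition massoc : {linear mtens (mtens V U) W -> mtens V (mtens U W)} :=
  mklin massoc_linear.
Lemma massoc_pure v u w : massoc (mpure (mpure v u) w) = mpure v (mpure u w).
Proof. exact: massoc_fun_pure. Qed.

Lemma assocV_bal1 (v : V) : balanced (@sratk k A U) (@slatk k A W)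
  (fun u w => mpure (mpure v u) w).
Proof.
split=> [w u u'|u w w'|u c w] /=; rewrite ?mpureDr ?mpureDl ?mpureDr //.
by rewrite /sratk /slatk -!mpureZ mtens_scalk.
Qed.
Lemma assocV_bal : balanced (@sratk k A V) (@slatk k A (mtens U W))
  (fun v s => \sw_(u, w <- s) mpure (mpure v u) w).
Proof.
split=> [s v v'|v s s'|v c s] /=.
- by rewrite -tens_lift_fD; apply: eq_tens_lift => u w; rewrite !mpureDl.
- exact: tens_liftD (assocV_bal1 v) _ _.
- move: s; apply: mtens_ext => [s s'|s s'|u w].
  + exact: tens_liftD (assocV_bal1 _) _ _.
  + by rewrite /slatk scalerDr (tens_liftD (assocV_bal1 v)).
  + rewrite /slatk mtens_scalk !(tens_lift_pure _ _ (assocV_bal1 _)).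
    by rewrite /sratk mpureZ.
Qed.
Definition massocV_fun (t : mtens V (mtens U W)) : mtens (mtens V U) W :=
  \sw_(v, s <- t) \sw_(u, w <- s) mpure (mpure v u) w.
Lemma massocV_funD : {morph massocV_fun : x y / x + y}.
Proof. exact: tens_liftD assocV_bal. Qed.
Lemma massocV_fun_pure v u w :
  massocV_fun (mpure v (mpure u w)) = mpure (mpure v u) w.
Proof.
rewrite /massocV_fun [LHS](tens_lift_pure _ _ assocV_bal).
exact: tens_lift_pure (assocV_bal1 v).
Qed.

Lemma mtens3_ext (B : zmodType) (F G : mtens (mtens V U) W -> B) :
  {morph F : x y / x + y} -> {morph G : x y / x + y} ->
  (forall v u w, F (mpure (mpure v u) w) = G (mpure (mpure v u) w)) -> F =1 G.
Proof.
move=> FD GD FG; apply: mtens_ext => // s w; move: s.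
by apply: mtens_ext => [s t|s t|v u]; rewrite ?mpureDl.
Qed.
Lemma mtens3_extr (B : zmodType) (F G : mtens V (mtens U W) -> B) :
  {morph F : x y / x + y} -> {morph G : x y / x + y} ->
  (forall v u w, F (mpure v (mpure u w)) = G (mpure v (mpure u w))) -> F =1 G.
Proof.
move=> FD GD FG; apply: mtens_ext => // v s; move: s.
by apply: mtens_ext => [s t|s t|u w]; rewrite ?mpureDr.
Qed.
Lemma massoc_funK : cancel massoc_fun massocV_fun.
Proof.
apply: mtens3_ext => [s t|//|v u w]; first by rewrite massoc_funD massocV_funD.
by rewrite massoc_fun_pure massocV_fun_pure.
Qed.
Lemma massocV_funK : cancel massocV_fun massoc_fun.
Proof.
apply: mtens3_extr => [s t|//|v u w]; first by rewrite massocV_funD massoc_funD.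
by rewrite massocV_fun_pure massoc_fun_pure.
Qed.
Lemma massocV_linear : linear massocV_fun.
Proof.
move=> x s t; apply: (can_inj massoc_funK); rewrite massocV_funK.
by rewrite massoc_linear !massocV_funK.
Qed.
Definition massocV : {linear mtens V (mtens U W) -> mtens (mtens V U) W} :=
  mklin massocV_linear.
Lemma massocV_pure v u w : massocV (mpure v (mpure u w)) = mpure (mpure v u) w.
Proof. exact: massocV_fun_pure. Qed.
End Assoc.

Section Unitors.
Variable V : lmodType A.
Lemma lunit_bal : balanced (@sratk k A (munit A)) (@slatk k A V)
  (fun c v => (c : k)%:A *: v).
Proof.
split=> [v c d|c v w|c d v] /=; rewrite ?scalerDr //; first by rewrite !scalerDl.
rewrite /sratk /slatk munit_scaleE linearZ /= rmorph1 mulr1 [in RHS]scalerA scalA_M.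
by rewrite (mulrC c).
Qed.
Definition lunit_fun (t : mtens (munit A) V) : V := \sw_(c, v <- t) ((c : k)%:A *: v).
Lemma lunit_funD : {morph lunit_fun : x y / x + y}.
Proof. exact: tens_liftD lunit_bal. Qed.
Lemma lunit_fun_pure (c : munit A) v : lunit_fun (mpure c v) = (c : k)%:A *: v.
Proof. exact: tens_lift_pure lunit_bal. Qed.
Lemma lunit_linear : linear lunit_fun.
Proof.
apply: mtens_linear => [|x c v]; first exact: lunit_funD.
rewrite mtens_scale_pure (tens_lift_comp _ _ lunit_funD) lunit_fun_pure.
rewrite scalerA scalA_comm -scalerA -[in RHS](counitl x).
rewrite (tens_lift_comp (h := fun x => x *: v)); last by move=> *; rewrite scalerDl.
rewrite (tens_lift_comp (h := fun v => c%:A *: v)); last by move=> *; rewrite scalerDr.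
apply: eq_tens_lift => a b; rewrite lunit_fun_pure munit_scaleE.
rewrite -[counit a *: b]mulr_algl [in LHS]scalerA [in RHS]scalerA mulrA scalA_M.
by rewrite (mulrC c).
Qed.
Definition lunit : {linear mtens (munit A) V -> V} := mklin lunit_linear.
Lemma lunit_pure (c : munit A) v : lunit (mpure c v) = (c : k)%:A *: v.
Proof. exact: lunit_fun_pure. Qed.

Definition lunitV_fun (v : V) : mtens (munit A) V := mpure ((1 : k) : munit A) v.
Lemma lunit_funK : cancel lunit_fun lunitV_fun.
Proof.
apply: mtens_ext => [s t|//|c v]; first by rewrite lunit_funD /lunitV_fun mpureDr.
by rewrite lunit_fun_pure /lunitV_fun -mpureZ munit_scaleE linearZ /= rmorph1 !mulr1.
Qed.
Lemma lunitV_funK : cancel lunitV_fun lunit_fun.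
Proof. by move=> v; rewrite lunit_fun_pure !scale1r. Qed.
Lemma lunitV_linear : linear lunitV_fun.
Proof.
move=> x s t; apply: (can_inj lunit_funK).
by rewrite lunit_linear !lunitV_funK.
Qed.
Definition lunitV : {linear V -> mtens (munit A) V} := mklin lunitV_linear.

Lemma runit_bal : balanced (@sratk k A V) (@slatk k A (munit A))
  (fun v (c : munit A) => (c : k)%:A *: v).
Proof.
split=> [c v w|v c d|v c d] /=; rewrite ?scalerDr //; first by rewrite !scalerDl.
rewrite /sratk /slatk munit_scaleE linearZ /= rmorph1 mulr1 [in LHS]scalerA scalA_M.
by rewrite (mulrC c).
Qed.
Definition runit_fun (t : mtens V (munit A)) : V := \sw_(v, c <- t) ((c : k)%:A *: v).
Lemma runit_funD : {morph runit_fun : x y / x + y}.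
Proof. exact: tens_liftD runit_bal. Qed.
Lemma runit_fun_pure (c : munit A) v : runit_fun (mpure v c) = (c : k)%:A *: v.
Proof. exact: tens_lift_pure runit_bal. Qed.
Lemma runit_linear : linear runit_fun.
Proof.
apply: mtens_linear => [|x v c]; first exact: runit_funD.
rewrite mtens_scale_pure (tens_lift_comp _ _ runit_funD) runit_fun_pure.
rewrite scalerA scalA_comm -scalerA -[in RHS](counitr x).
rewrite (tens_lift_comp (h := fun x => x *: v)); last by move=> *; rewrite scalerDl.
rewrite (tens_lift_comp (h := fun v => c%:A *: v)); last by move=> *; rewrite scalerDr.
apply: eq_tens_lift => a b; rewrite runit_fun_pure munit_scaleE.
rewrite -[counit b *: a]mulr_algl [in LHS]scalerA [in RHS]scalerA mulrA scalA_M.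
by rewrite (mulrC c).
Qed.
Definition runit : {linear mtens V (munit A) -> V} := mklin runit_linear.
Lemma runit_pure (c : munit A) v : runit (mpure v c) = (c : k)%:A *: v.
Proof. exact: runit_fun_pure. Qed.

Definition runitV_fun (v : V) : mtens V (munit A) := mpure v ((1 : k) : munit A).
Lemma runit_funK : cancel runit_fun runitV_fun.
Proof.
apply: mtens_ext => [s t|//|v c]; first by rewrite runit_funD /runitV_fun mpureDl.
by rewrite runit_fun_pure /runitV_fun mpureZ munit_scaleE linearZ /= rmorph1 !mulr1.
Qed.
Lemma runitV_funK : cancel runitV_fun runit_fun.
Proof. by move=> v; rewrite runit_fun_pure !scale1r. Qed.
Lemma runitV_linear : linear runitV_fun.
Proof.
move=> x s t; apply: (can_inj runit_funK).
by rewrite runit_linear !runitV_funK.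
Qed.
Definition runitV : {linear V -> mtens V (munit A)} := mklin runitV_linear.
End Unitors.
End ModMaps.

Record category := Category {
  obj :> Type;
  hom : obj -> obj -> Type;
  idm : forall X, hom X X;
  comp : forall X Y Z, hom Y Z -> hom X Y -> hom X Z;
  comp_idl : forall X Y (f : hom X Y), comp (idm Y) f = f;
  comp_idr : forall X Y (f : hom X Y), comp f (idm X) = f;
  compA : forall W X Y Z (h : hom Y Z) (g : hom X Y) (f : hom W X),
    comp h (comp g f) = comp (comp h g) f
}.
Arguments hom {c} X Y.
Arguments idm {c} X.
Arguments comp {c X Y Z} g f.
Notation "g '∘' f" := (comp g f) (at level 40, left associativity).

Record functor (C D : category) := Functor {
  fobj :> C -> D;
  fmap : forall X Y : C, hom X Y -> hom (fobj X) (fobj Y);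
  fmap_id : forall X, fmap (idm X) = idm (fobj X);
  fmap_comp : forall X Y Z (g : hom Y Z) (f : hom X Y),
    fmap (g ∘ f) = fmap g ∘ fmap f
}.
Arguments fmap {C D} F {X Y} f : rename.

Record moncat := MonCat {
  mcat :> category;
  mobj : mcat -> mcat -> mcat;
  mhom : forall X X' Y Y' : mcat,
    hom X X' -> hom Y Y' -> hom (mobj X Y) (mobj X' Y');
  mone : mcat;
  assoc : forall X Y Z, hom (mobj (mobj X Y) Z) (mobj X (mobj Y Z));
  associ : forall X Y Z, hom (mobj X (mobj Y Z)) (mobj (mobj X Y) Z);
  lun : forall X, hom (mobj mone X) X;
  luni : forall X, hom X (mobj mone X);
  run : forall X, hom (mobj X mone) X;
  runi : forall X, hom X (mobj X mone);
  mhom_id : forall X Y, mhom (idm X) (idm Y) = idm (mobj X Y);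
  mhom_comp : forall X X' X'' Y Y' Y'' (f' : hom X' X'') (f : hom X X')
      (g' : hom Y' Y'') (g : hom Y Y'),
    mhom (f' ∘ f) (g' ∘ g) = mhom f' g' ∘ mhom f g;
  assocK : forall X Y Z, associ X Y Z ∘ assoc X Y Z = idm _;
  associK : forall X Y Z, assoc X Y Z ∘ associ X Y Z = idm _;
  lunK : forall X, luni X ∘ lun X = idm _;
  luniK : forall X, lun X ∘ luni X = idm _;
  runK : forall X, runi X ∘ run X = idm _;
  runiK : forall X, run X ∘ runi X = idm _;
  assoc_nat : forall X X' Y Y' Z Z' (f : hom X X') (g : hom Y Y') (h : hom Z Z'),
    assoc X' Y' Z' ∘ mhom (mhom f g) h = mhom f (mhom g h) ∘ assoc X Y Z;
  lun_nat : forall X X' (f : hom X X'), lun X' ∘ mhom (idm mone) f = f ∘ lun X;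
  run_nat : forall X X' (f : hom X X'), run X' ∘ mhom f (idm mone) = f ∘ run X;
  pentagon : forall W X Y Z,
    assoc W X (mobj Y Z) ∘ assoc (mobj W X) Y Z =
    mhom (idm W) (assoc X Y Z) ∘ assoc W (mobj X Y) Z ∘ mhom (assoc W X Y) (idm Z);
  triangle : forall X Y,
    mhom (idm X) (lun Y) ∘ assoc X mone Y = mhom (run X) (idm Y)
}.
Arguments mhom {m X X' Y Y'} f g : rename.
Arguments mone {m}.
Notation "X ⊗ Y" := (mobj X Y) (at level 38, left associativity).
Notation "f ⊠ g" := (mhom f g) (at level 38, left associativity).

Section MonoidalFunctors.
Variables (C D : moncat) (F : functor C D).

Record lax_structure := LaxStructure {
  lax : forall X Y : C, hom (F X ⊗ F Y) (F (X ⊗ Y));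
  lax0 : hom mone (F mone);
  lax_nat : forall (X X' Y Y' : C) (f : hom X X') (g : hom Y Y'),
    fmap F (f ⊠ g) ∘ lax X Y = lax X' Y' ∘ (fmap F f ⊠ fmap F g);
  lax_assoc : forall X Y Z : C,
    fmap F (assoc X Y Z) ∘ lax (X ⊗ Y) Z ∘ (lax X Y ⊠ idm (F Z)) =
    lax X (Y ⊗ Z) ∘ (idm (F X) ⊠ lax Y Z) ∘ assoc (F X) (F Y) (F Z);
  lax_unitl : forall X : C,
    fmap F (lun X) ∘ lax mone X ∘ (lax0 ⊠ idm (F X)) = lun (F X);
  lax_unitr : forall X : C,
    fmap F (run X) ∘ lax X mone ∘ (idm (F X) ⊠ lax0) = run (F X)
}.

Record oplax_structure := OplaxStructure {
  oplax : forall X Y : C, hom (F (X ⊗ Y)) (F X ⊗ F Y);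
  oplax0 : hom (F mone) mone;
  oplax_nat : forall (X X' Y Y' : C) (f : hom X X') (g : hom Y Y'),
    oplax X' Y' ∘ fmap F (f ⊠ g) = (fmap F f ⊠ fmap F g) ∘ oplax X Y;
  oplax_assoc : forall X Y Z : C,
    assoc (F X) (F Y) (F Z) ∘ (oplax X Y ⊠ idm (F Z)) ∘ oplax (X ⊗ Y) Z =
    (idm (F X) ⊠ oplax Y Z) ∘ oplax X (Y ⊗ Z) ∘ fmap F (assoc X Y Z);
  oplax_unitl : forall X : C,
    lun (F X) ∘ (oplax0 ⊠ idm (F X)) ∘ oplax mone X = fmap F (lun X);
  oplax_unitr : forall X : C,
    run (F X) ∘ (idm (F X) ⊠ oplax0) ∘ oplax X mone = fmap F (run X)
}.

(* The associators, suppressed in the usual strict notation, are inserted. *)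
Definition frobenius_monoidal (L : lax_structure) (O : oplax_structure) : Prop :=
  forall X Y Z : C,
    (lax L X Y ⊠ idm (F Z)) ∘ associ (F X) (F Y) (F Z) ∘ (idm (F X) ⊠ oplax O Y Z)
      = oplax O (X ⊗ Y) Z ∘ fmap F (associ X Y Z) ∘ lax L X (Y ⊗ Z)
    /\ (idm (F X) ⊠ lax L Y Z) ∘ assoc (F X) (F Y) (F Z) ∘ (oplax O X Y ⊠ idm (F Z))
      = oplax O X (Y ⊗ Z) ∘ fmap F (assoc X Y Z) ∘ lax L (X ⊗ Y) Z.
End MonoidalFunctors.

Section ModCat.
Variables (k : fieldType) (A : hopfAlgType k).
Implicit Types V W X Y Z : lmodType A.

Definition lcomp X Y Z (g : {linear Y -> Z}) (f : {linear X -> Y}) :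
  {linear X -> Z} := g \o f.

Lemma lcompE X Y Z (g : {linear Y -> Z}) (f : {linear X -> Y}) x :
  lcomp g f x = g (f x).
Proof. by []. Qed.

Fact mod_comp_idl X Y (f : {linear X -> Y}) : lcomp idfun f = f.
Proof. exact: linear_ext. Qed.
Fact mod_comp_idr X Y (f : {linear X -> Y}) : lcomp f idfun = f.
Proof. exact: linear_ext. Qed.
Fact mod_compA W X Y Z (h : {linear Y -> Z}) (g : {linear X -> Y})
  (f : {linear W -> X}) : lcomp h (lcomp g f) = lcomp (lcomp h g) f.
Proof. exact: linear_ext. Qed.

Definition mod_category : category :=
  Category mod_comp_idl mod_comp_idr mod_compA.

Lemma mtens_hom_ext V U W (f g : {linear mtens V U -> W}) :
  (forall v u, f (mpure v u) = g (mpure v u)) -> f = g.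
Proof.
by move=> fg; apply: linear_ext; apply: mtens_ext => // x y; rewrite linearD.
Qed.
Lemma mtens3_hom_ext V U W Z (f g : {linear mtens (mtens V U) W -> Z}) :
  (forall v u w, f (mpure (mpure v u) w) = g (mpure (mpure v u) w)) -> f = g.
Proof.
by move=> fg; apply: linear_ext; apply: mtens3_ext => // x y; rewrite linearD.
Qed.

Fact mod_mhom_id X Y : mmap (idfun : {linear X -> X}) (idfun : {linear Y -> Y}) = idfun.
Proof. by apply: mtens_hom_ext => v u; rewrite mmap_pure. Qed.
Fact mod_mhom_comp X X' X'' Y Y' Y'' (f' : {linear X' -> X''}) (f : {linear X -> X'})
  (g' : {linear Y' -> Y''}) (g : {linear Y -> Y'}) :
  mmap (lcomp f' f) (lcomp g' g) = lcomp (mmap f' g') (mmap f g).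
Proof. by apply: mtens_hom_ext => v u; rewrite !lcompE !mmap_pure. Qed.
Fact mod_assocK X Y Z : lcomp (massocV X Y Z) (massoc X Y Z) = idfun.
Proof. by apply: linear_ext; exact: massoc_funK. Qed.
Fact mod_associK X Y Z : lcomp (massoc X Y Z) (massocV X Y Z) = idfun.
Proof. by apply: linear_ext; exact: massocV_funK. Qed.
Fact mod_lunK X : lcomp (lunitV X) (lunit X) = idfun.
Proof. by apply: linear_ext; exact: lunit_funK. Qed.
Fact mod_luniK X : lcomp (lunit X) (lunitV X) = idfun.
Proof. by apply: linear_ext; exact: lunitV_funK. Qed.
Fact mod_runK X : lcomp (runitV X) (runit X) = idfun.
Proof. by apply: linear_ext; exact: runit_funK. Qed.
Fact mod_runiK X : lcomp (runit X) (runitV X) = idfun.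
Proof. by apply: linear_ext; exact: runitV_funK. Qed.
Fact mod_assoc_nat X X' Y Y' Z Z' (f : {linear X -> X'}) (g : {linear Y -> Y'})
  (h : {linear Z -> Z'}) :
  lcomp (massoc X' Y' Z') (mmap (mmap f g) h) =
  lcomp (mmap f (mmap g h)) (massoc X Y Z).
Proof.
apply: mtens3_hom_ext => v u w.
by rewrite !lcompE massoc_pure !mmap_pure massoc_pure.
Qed.
Fact mod_lun_nat X X' (f : {linear X -> X'}) :
  lcomp (lunit X') (mmap idfun f) = lcomp f (lunit X).
Proof.
by apply: mtens_hom_ext => c v; rewrite !lcompE mmap_pure !lunit_pure linearZ.
Qed.
Fact mod_run_nat X X' (f : {linear X -> X'}) :
  lcomp (runit X') (mmap f idfun) = lcomp f (runit X).
Proof.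
by apply: mtens_hom_ext => c v; rewrite !lcompE mmap_pure !runit_pure linearZ.
Qed.
Fact mod_pentagon W X Y Z :
  lcomp (massoc W X (mtens Y Z)) (massoc (mtens W X) Y Z) =
  lcomp (lcomp (mmap idfun (massoc X Y Z)) (massoc W (mtens X Y) Z))
    (mmap (massoc W X Y) idfun).
Proof.
apply: mtens3_hom_ext => s y z; move: s.
apply: mtens_ext => [s t|s t|w x]; try by rewrite !mpureDl linearD.
by rewrite !lcompE !(massoc_pure, mmap_pure).
Qed.
Fact mod_triangle X Y :
  lcomp (mmap idfun (lunit Y)) (massoc X (munit A) Y) = mmap (runit X) idfun.
Proof.
apply: mtens3_hom_ext => x c y.
by rewrite !lcompE massoc_pure !mmap_pure lunit_pure runit_pure mpureZ.
Qed.

Definition mod_moncat : moncat :=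
  @MonCat mod_category (fun V U => mtens V U : lmodType A)
    (fun _ _ _ _ f g => mmap f g) (munit A : lmodType A)
    (@massoc k A) (@massocV k A) (@lunit k A) (@lunitV k A) (@runit k A) (@runitV k A)
    mod_mhom_id mod_mhom_comp mod_assocK mod_associK mod_lunK mod_luniK
    mod_runK mod_runiK mod_assoc_nat mod_lun_nat mod_run_nat
    mod_pentagon mod_triangle.
End ModCat.

(* An inclusion K ⊂ H, presented as an injective morphism of Hopf algebras. *)
Record hopf_extension (k : fieldType) (K H : hopfAlgType k) := HopfExtension {
  incl :> {lrmorphism K -> H};
  incl_inj : injective incl;
  incl_comul : forall a : K,
    comul (incl a) = \sw_(b, c <- comul a) vpure (incl b) (incl c);
  incl_counit : forall a : K, counit (incl a) = counit a;
  incl_antipode : forall a : K, antipode (incl a) = incl (antipode a)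
}.

(* H ⊗_K V, with K acting on H on the right through the inclusion and H acting
   by left multiplication. *)
Section Induction.
Variables (k : fieldType) (K H : hopfAlgType k) (i : hopf_extension K H).

Section Obj.
Variable V : lmodType K.
Definition ind : Type :=
  tens (fun (h : H) (a : K) => h * i a) (fun (a : K) (v : V) => a *: v).
HB.instance Definition _ := GRing.Zmodule.on ind.
Definition ipure (h : H) (v : V) : ind := tens_pure _ _ h v.

Lemma ipure_balanced :
  balanced (fun (h : H) (a : K) => h * i a) (fun (a : K) (v : V) => a *: v) ipure.
Proof. exact: tens_pure_balanced. Qed.
Lemma ipureDl h h' v : ipure (h + h') v = ipure h v + ipure h' v.
Proof. exact: balDl ipure_balanced _ _ _. Qed.
Lemma ipureDr h v v' : ipure h (v + v') = ipure h v + ipure h v'.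
Proof. exact: balDr ipure_balanced _ _ _. Qed.
Lemma ipureZ h a v : ipure (h * i a) v = ipure h (a *: v).
Proof. exact: balZ ipure_balanced _ _ _. Qed.

Definition ind_scale (x : H) (t : ind) : ind := \sw_(h, v <- t) ipure (x * h) v.
Lemma ind_scale_balanced x : balanced (fun (h : H) (a : K) => h * i a)
  (fun (a : K) (v : V) => a *: v) (fun h v => ipure (x * h) v).
Proof.
by split=> [v h h'|h v v'|h a v] /=;
  rewrite ?mulrDr ?ipureDl ?ipureDr // mulrA ipureZ.
Qed.
Lemma ind_scaleDr : right_distributive ind_scale +%R.
Proof. by move=> x; exact: tens_liftD (ind_scale_balanced x). Qed.
Lemma ind_scale_pure x h v : ind_scale x (ipure h v) = ipure (x * h) v.
Proof. exact: tens_lift_pure (ind_scale_balanced x). Qed.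
Lemma ind_scaleA x y t : ind_scale x (ind_scale y t) = ind_scale (x * y) t.
Proof.
move: t; apply: tens_ext => [s t|s t|h v]; rewrite ?ind_scaleDr //.
by rewrite !ind_scale_pure mulrA.
Qed.
Lemma ind_scale1 : left_id 1 ind_scale.
Proof.
apply: tens_ext => [s t|//|h v]; first by rewrite ind_scaleDr.
by rewrite ind_scale_pure mul1r.
Qed.
Lemma ind_scaleDl t : {morph ind_scale^~ t : x y / x + y}.
Proof.
move=> x y; rewrite /ind_scale -tens_lift_fD.
by apply: eq_tens_lift => h v; rewrite mulrDl ipureDl.
Qed.
HB.instance Definition _ := GRing.Zmodule_isLmodule.Build H ind
  ind_scaleA ind_scale1 ind_scaleDr ind_scaleDl.

Lemma ind_scale_pureE (x h : H) v : x *: ipure h v = ipure (x * h) v.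
Proof. exact: ind_scale_pure. Qed.
Lemma ind_ext (B : zmodType) (F G : ind -> B) :
  {morph F : x y / x + y} -> {morph G : x y / x + y} ->
  (forall h v, F (ipure h v) = G (ipure h v)) -> F =1 G.
Proof. exact: tens_ext. Qed.
End Obj.

Section Map.
Variables (V W : lmodType K) (f : {linear V -> W}).
Definition imap_fun (t : ind V) : ind W := \sw_(h, v <- t) ipure h (f v).
Lemma imap_balanced : balanced (fun (h : H) (a : K) => h * i a)
  (fun (a : K) (v : V) => a *: v) (fun h v => ipure h (f v)).
Proof.
by split=> [v h h'|h v v'|h a v] /=;
  rewrite ?ipureDl ?linearD ?ipureDr // ipureZ linearZ.
Qed.
Lemma imap_linear : linear imap_fun.
Proof.
move=> x s t; rewrite [LHS](tens_liftD imap_balanced); congr (_ + _); move: s.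
apply: ind_ext => [s t'|s t'|h v].
- by rewrite scalerDr (tens_liftD imap_balanced).
- by rewrite -scalerDr; congr (_ *: _); exact: tens_liftD imap_balanced _ _.
- rewrite ind_scale_pureE [LHS](tens_lift_pure _ _ imap_balanced).
  by rewrite /imap_fun [tens_lift _ _](tens_lift_pure _ _ imap_balanced) ind_scale_pureE.
Qed.
Definition imap : {linear ind V -> ind W} := mklin imap_linear.
Lemma imap_pure h v : imap (ipure h v) = ipure h (f v).
Proof. exact: tens_lift_pure imap_balanced. Qed.
End Map.

Fact imap_id (V : lmodType K) : imap (idfun : {linear V -> V}) = idfun.
Proof.
apply: linear_ext; apply: ind_ext => [x y|//|h v]; first by rewrite linearD.
by rewrite imap_pure.
Qed.
Fact imap_comp (U V W : lmodType K) (g : {linear V -> W}) (f : {linear U -> V}) :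
  imap (lcomp g f) = lcomp (imap g) (imap f).
Proof.
apply: linear_ext; apply: ind_ext => [x y|x y|h v]; try by rewrite linearD.
by rewrite !lcompE !imap_pure.
Qed.

Definition Ind : functor (mod_moncat K) (mod_moncat H) :=
  @Functor (mod_moncat K) (mod_moncat H) (fun V => ind V : lmodType H)
    (fun V W f => imap f) imap_id imap_comp.
End Induction.

Definition fin_generated (R : pzRingType) (M : lmodType R) : Prop :=
  exists s : seq M, forall x : M,
    exists c : 'I_(size s) -> R, x = \sum_j c j *: s`_j.

Definition projective (R : pzRingType) (P : lmodType R) : Prop :=
  forall (M N : lmodType R) (p : {linear M -> N}) (f : {linear P -> N}),
    (forall y, exists x, p x = y) -> exists g : {linear P -> M}, p \o g =1 f.

Section Pointed.
Variables (k : fieldType) (H : hopfAlgType k).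

(* Over a field C ⊗ C embeds into H ⊗ H, so that Δ(C) ⊂ C ⊗ C says that Δ(x) is a
   sum of pure tensors with both factors in C, for every x in C. *)
Record subcoalgebra (C : H -> Prop) : Prop := Subcoalgebra {
  subcoalg0 : C 0;
  subcoalgP : forall (c : k) (x y : H), C x -> C y -> C (c *: x + y);
  subcoalg_comul : forall x : H, C x -> exists s : seq (H * H),
    (forall p, p \in s -> C p.1 /\ C p.2) /\ comul x = \sum_(p <- s) vpure p.1 p.2
}.

Definition simple_subcoalgebra (C : H -> Prop) : Prop :=
  [/\ subcoalgebra C, exists2 x, C x & x <> 0 &
      forall D : H -> Prop, subcoalgebra D -> (forall x, D x -> C x) ->
        (forall x, D x -> x = 0) \/ (forall x, C x -> D x)].

Definition pointed : Prop := forall C : H -> Prop, simple_subcoalgebra C ->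
  exists2 g : H, g <> 0 & forall x, C x <-> exists c : k, x = c *: g.
End Pointed.

(* H as a left K-module. *)
Definition resmod (k : fieldType) (K H : hopfAlgType k)
  (i : hopf_extension K H) : Type := H.

Section Extension.
Variables (k : fieldType) (K H : hopfAlgType k) (i : hopf_extension K H).

HB.instance Definition _ := GRing.Zmodule.copy (resmod i) H.
Definition res_scale (a : K) (h : resmod i) : resmod i := i a * (h : H).
Fact res_scaleA a b h : res_scale a (res_scale b h) = res_scale (a * b) h.
Proof. by rewrite /res_scale rmorphM mulrA. Qed.
Fact res_scale1 : left_id 1 res_scale.
Proof. by move=> h; rewrite /res_scale rmorph1 mul1r. Qed.
Fact res_scaleDr : right_distributive res_scale +%R.
Proof. by move=> a g h; rewrite /res_scale mulrDr. Qed.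
Fact res_scaleDl h : {morph res_scale^~ h : a b / a + b}.
Proof. by move=> a b; rewrite /res_scale rmorphD mulrDl. Qed.
HB.instance Definition _ := GRing.Zmodule_isLmodule.Build K (resmod i)
  res_scaleA res_scale1 res_scaleDr res_scaleDl.

Lemma resmod_scaleE (a : K) (h : resmod i) : a *: h = i a * (h : H).
Proof. by []. Qed.

(* The linearity of [tr] on the left is in its type; the second clause is the
   bijectivity of h |-> tr((-)h) from H onto Hom_K(H, K). *)
Definition frobenius_morphism (tr : {linear resmod i -> K^o}) : Prop :=
  (forall (h : H) (a : K), tr (h * i a) = tr h * a) /\
  (forall f : {linear resmod i -> K^o},
     exists! h : H, forall x : H, f x = tr (x * h)).

Definition frobenius_extension : Prop :=
  [/\ fin_generated (resmod i), projective (resmod i) &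
      exists tr, frobenius_morphism tr].

Definition dual_bases (tr : {linear resmod i -> K^o}) (n : nat) (hs ds : 'I_n -> H) :=
  forall h : H, h = \sum_j i (tr (h * ds j)) * hs j /\
                h = \sum_j ds j * i (tr (hs j * h)).

(* The left ideal HK^+ generated by the kernel of the counit of K. *)
Definition HKplus : {pred H} := fun x =>
  `[< exists s : seq (H * K), (forall p, p \in s -> counit p.2 = 0) /\
        x = \sum_(p <- s) p.1 * i p.2 >].

Lemma HKplusP x : reflect (exists s : seq (H * K),
  (forall p, p \in s -> counit p.2 = 0) /\ x = \sum_(p <- s) p.1 * i p.2)
  (x \in HKplus).
Proof. exact: asboolP. Qed.

Fact HKplus_submod : submod_closed HKplus.
Proof.
split=> [|c x y /HKplusP[s [s0 ->]] /HKplusP[t [t0 ->]]]; apply/HKplusP.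
  by exists [::]; split=> //; rewrite big_nil.
exists ([seq (c *: p.1, p.2) | p <- s] ++ t); split.
  by move=> p; rewrite mem_cat => /orP[/mapP[q qs ->]|/t0 //]; exact: (s0 q).
rewrite big_cat big_map scaler_sumr; congr (_ + _).
by apply: eq_bigr => p _; rewrite scalerAl.
Qed.
HB.instance Definition _ := GRing.isSubmodClosed.Build k H HKplus HKplus_submod.

Lemma HKplus_mul (h : H) (a : K) : counit a = 0 -> h * i a \in HKplus.
Proof.
move=> a0; apply/HKplusP; exists [:: (h, a)]; split; last by rewrite big_seq1.
by move=> p; rewrite inE => /eqP->.
Qed.

Definition Hbar : Type := {ideal_quot HKplus}.
HB.instance Definition _ := GRing.Zmodule.on Hbar.
Definition bar (h : H) : Hbar := \pi_{ideal_quot HKplus} h.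

Lemma bar_repr (x : Hbar) : bar (repr x) = x. Proof. exact: reprK. Qed.
Lemma bar_eq g h : bar g = bar h <-> g - h \in HKplus.
Proof.
rewrite Quotient.idealrBE.
by split=> [e|/eqP]; [apply/eqP|].
Qed.
Lemma barD : {morph bar : x y / x + y}.
Proof. by move=> x y; rewrite /bar raddfD. Qed.
Lemma repr_bar h : repr (bar h) - h \in HKplus.
Proof. by apply/bar_eq; rewrite bar_repr. Qed.

Definition bar_scale (c : k) (x : Hbar) : Hbar := bar (c *: repr x).
Lemma bar_scale_bar c h : bar_scale c (bar h) = bar (c *: h).
Proof. by apply/bar_eq; rewrite -scalerBr rpredZ ?repr_bar. Qed.
Fact bar_scaleA a b x : bar_scale a (bar_scale b x) = bar_scale (a * b) x.
Proof. by rewrite -(bar_repr x) !bar_scale_bar scalerA. Qed.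
Fact bar_scale1 : left_id 1 bar_scale.
Proof. by move=> x; rewrite -(bar_repr x) bar_scale_bar scale1r. Qed.
Fact bar_scaleDr : right_distributive bar_scale +%R.
Proof.
move=> a x y; rewrite -(bar_repr x) -(bar_repr y) -barD !bar_scale_bar -barD.
by rewrite scalerDr.
Qed.
Fact bar_scaleDl x : {morph bar_scale^~ x : a b / a + b}.
Proof. by move=> a b; rewrite -(bar_repr x) !bar_scale_bar -barD scalerDl. Qed.
HB.instance Definition _ := GRing.Zmodule_isLmodule.Build k Hbar
  bar_scaleA bar_scale1 bar_scaleDr bar_scaleDl.

Lemma barZ (c : k) h : bar (c *: h) = c *: bar h.
Proof. by rewrite -bar_scale_bar. Qed.

Lemma bar_mul_counit (h : H) (a : K) : bar (h * i a) = counit a *: bar h.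
Proof.
rewrite -barZ; apply/bar_eq.
have -> : h * i a - counit a *: h = h * i (a - (counit a)%:A).
  have ic : i (counit a)%:A = (counit a)%:A by rewrite linearZ /= rmorph1.
  by rewrite raddfB [X in _ * (_ - X)]ic mulrBr -scalerAr mulr1.
have e : counit ((counit a)%:A : K) = counit a by rewrite linearZ /= rmorph1 mulr1.
by apply: HKplus_mul; rewrite raddfB [X in _ - X]e subrr.
Qed.

(* The product of the dual of H/HK^+, see [convE]. *)
Section Convolution.
Variables mu nu : {linear Hbar -> k^o}.

Definition conv_rep (h : H) : k := \sw_(a, b <- comul h) (mu (bar a) * nu (bar b)).

Lemma conv_bal : balanced (fun (a : H) (c : k) => c *: a)
  (fun (c : k) (a : H) => c *: a) (fun a b => mu (bar a) * nu (bar b)).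
Proof.
split=> [b a a'|a b b'|a c b] /=.
- by rewrite barD linearD mulrDl.
- by rewrite barD linearD mulrDr.
- by rewrite !barZ !linearZ /= -[LHS]mulrA mulrCA.
Qed.
Lemma conv_repD : {morph conv_rep : x y / x + y}.
Proof. by move=> x y; rewrite /conv_rep linearD (tens_liftD conv_bal). Qed.
Lemma conv_repZ c x : conv_rep (c *: x) = c * conv_rep x.
Proof.
rewrite /conv_rep linearZ /=; move: (comul x); apply: tens_ext => [s t|s t|a b].
- by rewrite scalerDr (tens_liftD conv_bal).
- by rewrite (tens_liftD conv_bal) mulrDr.
- rewrite vtens_scale_pure !(tens_lift_pure _ _ conv_bal).
  by rewrite barZ linearZ -[LHS]mulrA.
Qed.
Lemma conv_rep_mul h a : conv_rep (h * i a) = counit a * conv_rep h.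
Proof.
have FD := tens_liftD conv_bal.
have bal2 (x y : H) : balanced (fun (a : H) (c : k) => c *: a)
    (fun (c : k) (a : H) => c *: a)
    (fun c d => mu (bar (x * c)) * nu (bar (y * d))).
  split=> [b c c'|c b b'|c e b] /=.
  - by rewrite mulrDr barD linearD mulrDl.
  - by rewrite mulrDr barD linearD mulrDr.
  - by rewrite -!scalerAr !barZ !linearZ /= -[LHS]mulrA mulrCA.
rewrite /conv_rep comulM incl_comul /vtens_mul (tens_lift_comp _ _ FD).
rewrite (tens_lift_comp (h := fun z : k => counit a * z)); last exact: mulrDr.
apply: eq_tens_lift => x y; rewrite (tens_lift_comp _ _ FD).
transitivity (tens_lift (fun c d => mu (bar (x * c)) * nu (bar (y * d)))
    (\sw_(b, c <- comul a) vpure (i b) (i c))).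
  by apply: eq_tens_lift => c d; rewrite [LHS](tens_lift_pure _ _ conv_bal).
rewrite (tens_lift_comp _ _ (tens_liftD (bal2 x y))).
transitivity (tens_lift (fun b c : K =>
    counit b * counit c * (mu (bar x) * nu (bar y)) : k) (comul a)).
  apply: eq_tens_lift => b c; rewrite [LHS](tens_lift_pure _ _ (bal2 x y)).
  by rewrite !bar_mul_counit !linearZ /= mulrACA.
rewrite -(tens_lift_comp (h := fun z : k => z * (mu (bar x) * nu (bar y)))); last first.
  by move=> *; rewrite mulrDl.
congr (_ * _); rewrite -[in RHS](counitl a).
rewrite [RHS](tens_lift_comp (h := fun z => counit z : k)); last first.
  by move=> *; rewrite linearD.
by apply: eq_tens_lift => b c; rewrite linearZ.
Qed.

Lemma conv_rep_bar g h : bar g = bar h -> conv_rep g = conv_rep h.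
Proof.
move=> /bar_eq/HKplusP[s [s0 e]]; rewrite -(subrK h g) e conv_repD.
rewrite -[RHS]add0r; congr (_ + _).
elim: s s0 {e} => [|[x a] s IH] s0.
  by rewrite big_nil; apply: (addrI (conv_rep 0)); rewrite -conv_repD !addr0.
rewrite big_cons conv_repD conv_rep_mul (s0 (x, a)) ?mem_head // mul0r add0r.
by apply: IH => p ps; rewrite s0 // inE ps orbT.
Qed.

Definition conv_fun (x : Hbar) : k^o := conv_rep (repr x).
Lemma conv_fun_bar h : conv_fun (bar h) = conv_rep h.
Proof. by apply: conv_rep_bar; rewrite bar_repr. Qed.
Fact conv_linear : linear conv_fun.
Proof.
move=> c x y; rewrite -(bar_repr x) -(bar_repr y) -barZ -barD !conv_fun_bar.
by rewrite conv_repD conv_repZ.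
Qed.
Definition conv : {linear Hbar -> k^o} := mklin conv_linear.
Lemma convE h : conv (bar h) = \sw_(a, b <- comul h) (mu (bar a) * nu (bar b)) :> k.
Proof. exact: conv_fun_bar. Qed.
End Convolution.

Definition right_integral (lam : {linear Hbar -> k^o}) : Prop :=
  forall mu : {linear Hbar -> k^o}, forall x, conv lam mu x = mu (bar 1) *: lam x.

Definition right_integral_type : Prop :=
  exists (lam : {linear Hbar -> k^o}) (Lam : H) (chi : {lrmorphism K -> k | *%R}),
    [/\ right_integral lam, exists x, lam x <> 0,
        forall h : H, lam (bar (Lam * h)) = counit h &
        forall (a : K) (h : H), lam (bar (i a * h)) = chi a * lam (bar h)].
End Extension.

Section IndStructures.
Variables (k : fieldType) (K H : hopfAlgType k) (i : hopf_extension K H).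

(* The pure tensors generate, so these formulas determine the structure maps of
   [L] and [O]; in particular they say that the formulas are well defined. *)
Definition ind_lax (tr : {linear resmod i -> K^o}) (n : nat) (hs ds : 'I_n -> H)
    (L : lax_structure (Ind i)) : Prop :=
  (forall (V U : lmodType K) (h g : H) (v : V) (u : U),
     (lax L V U : {linear mtens (ind i V) (ind i U) -> ind i (mtens V U)})
       (mpure (ipure i h v) (ipure i g u)) =
     \sum_j ipure i (ds j)
       (\sw_(a, b <- comul (hs j)) mpure (tr (a * h) *: v) (tr (b * g) *: u))) /\
  (lax0 L : {linear munit H -> ind i (munit K)}) (1 : k) =
    \sum_j ipure i (ds j) (counit (hs j) : munit K).

Definition ind_oplax (O : oplax_structure (Ind i)) : Prop :=
  (forall (V U : lmodType K) (h : H) (v : V) (u : U),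
     (oplax O V U : {linear ind i (mtens V U) -> mtens (ind i V) (ind i U)})
       (ipure i h (mpure v u)) =
     \sw_(a, b <- comul h) mpure (ipure i a v) (ipure i b u)) /\
  (forall h : H, (oplax0 O : {linear ind i (munit K) -> munit H})
     (ipure i h ((1 : k) : munit K)) = counit h).

Definition ind_frobenius_monoidal : Prop :=
  exists (tr : {linear resmod i -> K^o}) (n : nat) (hs ds : 'I_n -> H)
    (L : lax_structure (Ind i)) (O : oplax_structure (Ind i)),
    [/\ frobenius_morphism tr, dual_bases tr hs ds, ind_lax tr hs ds L,
        ind_oplax O & frobenius_monoidal L O].
End IndStructures.

(* Main.v *)
Require Import Defs.
From mathcomp Require Import all_boot all_algebra.

(** For a Frobenius morphism tr there is R = Σ g ⊗ z in H ⊗ H, called the twist below, with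
    Δ(tr(y)) = Σ tr(g y_1) ⊗ z y_2.  By coassociativity and the nondegeneracy of tr it
    satisfies (R ⊗ 1)(Δ ⊗ 1)(R) = (1 ⊗ Δ)(R), and it commutes with Δ(K).  It follows
    that u = Σ g S(z) is a unit of H commuting with K, with inverse v = Σ ε(g) z, and that
    R = (u ⊗ 1)Δ(v).  Therefore f = tr(u -) is a Frobenius morphism which is right
    H-colinear: f(x)_1 ⊗ f(x)_2 = f(x_1) ⊗ x_2.  The right colinear maps being essentially
    unique, there is also b in H with x_1 ⊗ f(x_2) = b f(x)_1 ⊗ f(x)_2.

    Write θ : Ind M -> M for h ⊗ m |-> f(h)m and η : M -> Ind M for m |-> 1 ⊗ m.  The lax
    structure is the H-linear map with θ lax = θ ⊗ θ, and the two properties of f say that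
    (θ ⊗ 1) oplax = (1 ⊗ η) θ and (1 ⊗ θ) oplax = (bη ⊗ 1) θ.  The Frobenius relations
    follow, since an H-linear map to Ind M ⊗ N is determined by its composite with
    θ ⊗ 1, and one to N ⊗ Ind M by its composite with 1 ⊗ θ. *)

Set Implicit Arguments.
Unset Strict Implicit.
Unset Printing Implicit Defensive.

Import GRing.Theory.
Local Open Scope ring_scope.

(** * Linear maps and Sweedler sums *)

Section Linear.
Variable k : fieldType.
Implicit Types U V W A : lmodType k.

(** Linearity of a bare function, under a head symbol that the tactic [lin] can match for any
    abstraction. *)
Definition lin U A (f : U -> A) : Prop := linear f.

Lemma linD U A (f : U -> A) : lin f -> {morph f : x y / x + y}.
Proof. by move=> h x y; have := h 1 x y; rewrite !scale1r. Qed.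
Lemma lin0 U A (f : U -> A) : lin f -> f 0 = 0.
Proof. by move=> /linD h; apply: (addrI (f 0)); rewrite -h !addr0. Qed.
Lemma linZ U A (f : U -> A) : lin f -> forall c x, f (c *: x) = c *: f x.
Proof. by move=> h c x; have := h c x 0; rewrite addr0 (lin0 h) addr0. Qed.
Lemma lin_sum U A (f : U -> A) I (r : seq I) (E : I -> U) :
  lin f -> f (\sum_(j <- r) E j) = \sum_(j <- r) f (E j).
Proof. by move=> h; apply: (big_morph f (linD h) (lin0 h)). Qed.

Definition bil U V A (f : U -> V -> A) : Prop :=
  (forall v, lin (f^~ v)) /\ (forall u, lin (f u)).

Lemma bil_balanced U V A (f : U -> V -> A) : bil f ->
  balanced (fun v (c : k) => c *: v) (fun (c : k) w => c *: w) f.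
Proof.
move=> [fl fr]; split=> [v|u|u c v]; first exact: linD (fl v).
  exact: linD (fr u).
by rewrite (linZ (fl v)) (linZ (fr u)).
Qed.

Lemma vpure_bil U V : bil (@vpure k U V).
Proof.
have vb := vpure_balanced U V.
split=> [v c x y|u c x y]; first by rewrite (balDl vb) vtens_scale_pure.
by rewrite (balDr vb) vtens_scale_pure (balZ vb).
Qed.

Lemma lin_comp U V A (g : V -> A) (f : U -> V) :
  lin g -> lin f -> lin (fun x => g (f x)).
Proof. by move=> gl fl c x y; rewrite fl gl. Qed.
Lemma lin_id U : lin (fun x : U => x).
Proof. by []. Qed.
Lemma lin_lin U A (g : {linear U -> A}) : lin g.
Proof. by move=> c x y; rewrite linearP. Qed.
Lemma lin_vpurel U V W (f : U -> V) (w : W) : lin f -> lin (fun x => vpure (f x) w).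
Proof. exact: lin_comp ((vpure_bil V W).1 w). Qed.
Lemma lin_vpurer U V W (f : U -> W) (v : V) : lin f -> lin (fun x => vpure v (f x)).
Proof. exact: lin_comp ((vpure_bil V W).2 v). Qed.
Lemma lin_scaler U A (f : U -> A) c : lin f -> lin (fun x => c *: f x).
Proof. by move=> fl d x y; rewrite fl scalerDr !scalerA mulrC. Qed.
Lemma lin_scalel U A (f : U -> k^o) (a : A) : lin f -> lin (fun x => f x *: a).
Proof. by move=> fl d x y; rewrite fl scalerDl -scalerA. Qed.
Lemma lin_bigsum U A I (r : seq I) (f : I -> U -> A) :
  (forall j, lin (f j)) -> lin (fun x => \sum_(j <- r) f j x).
Proof.
move=> fl c x y; rewrite scaler_sumr -big_split; apply: eq_bigr => j _.
exact: fl.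
Qed.
Lemma lin_swr U V W A (f : U -> V -> W -> A) (t : vtens V W) :
  (forall v w, lin (fun x => f x v w)) -> lin (fun x => \sw_(v, w <- t) f x v w).
Proof. by move=> fl; apply: lin_bigsum => p; exact: fl. Qed.
Lemma lin_lift V W A (f : V -> W -> A) : bil f -> lin (fun t : vtens V W => tens_lift f t).
Proof.
move=> fb c s t; have fl := bil_balanced fb.
rewrite (tens_liftD fl); congr (_ + _); move: s; apply: tens_ext => [x y|x y|v w].
- by rewrite scalerDr (tens_liftD fl).
- by rewrite (tens_liftD fl) scalerDr.
by rewrite vtens_scale_pure !(tens_lift_pure _ _ fl) (linZ (fb.1 w)).
Qed.
Lemma lin_swl U V W A (f : V -> W -> A) (t : U -> vtens V W) :
  (forall w, lin (f^~ w)) -> (forall v, lin (f v)) -> lin t ->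
  lin (fun x => \sw_(v, w <- t x) f v w).
Proof. by move=> fl fr; apply: lin_comp; apply: lin_lift. Qed.

Section Sw.
Variables (U V W X : lmodType k) (A : lmodType k).

Lemma sw_lin (g : W -> A) (f : U -> V -> W) (t : vtens U V) : lin g ->
  g (\sw_(u, v <- t) f u v) = \sw_(u, v <- t) g (f u v).
Proof. by move=> gl; apply: tens_lift_comp; exact: linD gl. Qed.
Lemma sw_sw (f : U -> V -> A) (E : W -> X -> vtens U V) (t : vtens W X) : bil f ->
  \sw_(u, v <- \sw_(w, x <- t) E w x) f u v = \sw_(w, x <- t) \sw_(u, v <- E w x) f u v.
Proof. by move=> fb; rewrite (tens_lift_comp _ _ (tens_liftD (bil_balanced fb))). Qed.
Lemma sw_pure (f : U -> V -> A) u v : bil f -> \sw_(x, y <- vpure u v) f x y = f u v.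
Proof. by move=> fb; rewrite [LHS](tens_lift_pure _ _ (bil_balanced fb)). Qed.
Lemma sw_sum (f : U -> V -> A) I (r : seq I) (E : I -> vtens U V) : bil f ->
  \sw_(u, v <- \sum_(j <- r) E j) f u v = \sum_(j <- r) \sw_(u, v <- E j) f u v.
Proof. by move=> /lin_lift h; rewrite (lin_sum _ _ h). Qed.
Lemma sum_sw I (r : seq I) (E : I -> U -> V -> A) (t : vtens U V) :
  \sw_(u, v <- t) (\sum_(j <- r) E j u v) = \sum_(j <- r) \sw_(u, v <- t) E j u v.
Proof. exact: exchange_big. Qed.
End Sw.
End Linear.

Section HopfLin.
Variables (k : fieldType) (H : hopfAlgType k) (U : lmodType k).
Implicit Types f : U -> H.
Lemma lin_comul f : lin f -> lin (fun x => comul (f x)).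
Proof. exact: lin_comp (lin_lin (@comul k H)). Qed.
Lemma lin_antipode f : lin f -> lin (fun x => antipode (f x)).
Proof. exact: lin_comp (lin_lin (@antipode k H)). Qed.
Lemma lin_counit f : lin f -> @lin k U k^o (fun x => counit (f x)).
Proof. by move=> fl c x y; rewrite fl linearP. Qed.
Lemma lin_mull f b : lin f -> lin (fun x => f x * b).
Proof. by move=> fl c x y; rewrite fl mulrDl scalerAl. Qed.
Lemma lin_mulr f b : lin f -> lin (fun x => b * f x).
Proof. by move=> fl c x y; rewrite fl mulrDr scalerAr. Qed.
End HopfLin.

Lemma lin_incl (k : fieldType) (K H : hopfAlgType k) (i : hopf_extension K H)
  (U : lmodType k) (f : U -> K) : lin f -> lin (fun x => i (f x)).
Proof. by move=> fl c x y; rewrite fl linearP. Qed.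

Lemma lin_incl0 (k : fieldType) (K H : hopfAlgType k) (i : hopf_extension K H) : lin i.
Proof. by move=> c x y; rewrite linearP. Qed.
Lemma lin_counit0 (k : fieldType) (H : hopfAlgType k) : @lin k H k^o counit.
Proof. by move=> c x y; rewrite linearP. Qed.

(** Each branch peels the outermost operation off the body of the abstraction. In a Sweedler sum the
    variable sits either in the summand or in the element summed over, whence the two branches
    [lin_swr] and [lin_swl]. *)
Ltac lin1 := first
  [ exact: lin_id | assumption | exact: lin_lin | exact: lin_incl0 | exact: lin_counit0
  | refine (lin_vpurel _ _) | refine (lin_vpurer _ _)
  | refine (lin_mull _ _) | refine (lin_mulr _ _)
  | refine (lin_scaler _ _) | refine (lin_scalel _ _)
  | refine (lin_comul _) | refine (lin_antipode _) | refine (lin_counit _)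
  | refine (lin_incl _ _)
  | match goal with h : lin ?g |- lin (fun x => ?g (@?f x)) =>
      refine (@lin_comp _ _ _ _ g f h _) end
  | match goal with h : bil ?g |- lin (fun x => ?g ?b (@?f x)) =>
      refine (@lin_comp _ _ _ _ (g b) f (h.2 b) _) end
  | match goal with h : bil ?g |- lin (fun x => ?g (@?f x) ?b) =>
      refine (@lin_comp _ _ _ _ (fun y => g y b) f (h.1 b) _) end
  | refine (lin_swr _ _); intros ? ?
  | refine (lin_swl _ _ _); [intros ? | intros ? | ]
  | refine (lin_bigsum _); intros ? ].
Ltac lin := intros; cbv beta; match goal with
  | |- bil _ => split; intros ?; cbv beta; lin
  | |- lin _ => repeat (lin1; cbv beta)
  | |- _ => assumption end.

(** * Hopf algebra axioms inside Sweedler sums *)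

Section Sweedler.
Variables (k : fieldType) (H : hopfAlgType k) (A : lmodType k).
Implicit Types (h : H).

Lemma swA (T : H -> H -> H -> A) h :
  (forall b c, lin (fun a => T a b c)) -> (forall a c, lin (fun b => T a b c)) ->
  (forall a b, lin (T a b)) ->
  \sw_(a, b <- comul h) \sw_(c, d <- comul b) T a c d =
  \sw_(a, b <- comul h) \sw_(c, d <- comul a) T c d b.
Proof.
move=> T1 T2 T3.
have gb : bil (fun a (t : vtens H H) => \sw_(c, d <- t) T a c d).
  split=> [t|a]; last by apply: lin_lift; split=> [c|c]; [exact: T2|exact: T3].
  by apply: lin_swr => c d; exact: T1.
have ib a : bil (T a) by split=> [c|c]; [exact: T2|exact: T3].
have /(congr1 (tens_lift (fun a (t : vtens H H) => \sw_(c, d <- t) T a c d))) := comulA h.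
rewrite !(sw_sw _ _ gb) => e; apply: etrans (etrans e _).
  apply: eq_tens_lift => a b; rewrite (sw_sw _ _ gb).
  by apply: eq_tens_lift => c d; rewrite (sw_pure _ _ gb) (sw_pure _ _ (ib a)).
apply: eq_tens_lift => a b; rewrite (sw_sw _ _ gb).
by apply: eq_tens_lift => c d; rewrite (sw_pure _ _ gb) (sw_pure _ _ (ib c)).
Qed.

Lemma swM (T : H -> H -> A) (g h : H) : bil T ->
  \sw_(a, b <- comul (g * h)) T a b =
  \sw_(a, b <- comul g) \sw_(c, d <- comul h) T (a * c) (b * d).
Proof.
move=> Tb; rewrite comulM /vtens_mul (sw_sw _ _ Tb).
apply: eq_tens_lift => a b; rewrite (sw_sw _ _ Tb).
by apply: eq_tens_lift => c d; rewrite (sw_pure _ _ Tb).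
Qed.

Lemma sw1 (T : H -> H -> A) : bil T -> \sw_(a, b <- comul 1) T a b = T 1 1.
Proof. by move=> Tb; rewrite comul1 (sw_pure _ _ Tb). Qed.

Lemma sw_counitl (F : H -> A) h : lin F ->
  \sw_(a, b <- comul h) (counit a *: F b) = F h.
Proof.
move=> Fl; rewrite -[in RHS](counitl h) (sw_lin _ _ Fl).
by apply: eq_tens_lift => a b; rewrite (linZ Fl).
Qed.
Lemma sw_counitr (F : H -> A) h : lin F ->
  \sw_(a, b <- comul h) (counit b *: F a) = F h.
Proof.
move=> Fl; rewrite -[in RHS](counitr h) (sw_lin _ _ Fl).
by apply: eq_tens_lift => a b; rewrite (linZ Fl).
Qed.
Lemma sw_antipodel (F : H -> A) h : lin F ->
  \sw_(a, b <- comul h) F (antipode a * b) = counit h *: F 1.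
Proof. by move=> Fl; rewrite -(linZ Fl) -antipodel (sw_lin _ _ Fl). Qed.
Lemma sw_antipoder (F : H -> A) h : lin F ->
  \sw_(a, b <- comul h) F (a * antipode b) = counit h *: F 1.
Proof. by move=> Fl; rewrite -(linZ Fl) -antipoder (sw_lin _ _ Fl). Qed.

(* The map y ⊗ c |-> y_1 ⊗ y_2 c is bijective, with inverse y ⊗ c |-> y_1 ⊗ S(y_2) c. *)
Lemma sw_cancel (T T' : H -> H -> A) : bil T -> bil T' ->
  (forall y c, \sw_(a, b <- comul y) T a (b * c) = \sw_(a, b <- comul y) T' a (b * c)) ->
  forall y c, T y c = T' y c.
Proof.
move=> Tb T'b e.
suff main (S : H -> H -> A) : bil S -> forall y c, S y c =
    \sw_(a, b <- comul y) \sw_(d, e <- comul a) S d (e * (antipode b * c)).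
  move=> y c; rewrite (main _ Tb) (main _ T'b).
  by apply: eq_tens_lift => a b; exact: e.
move=> Sb y c; rewrite -(swA (T := fun d e b => S d (e * (antipode b * c)))); try by lin.
transitivity (\sw_(a, b <- comul y) (counit b *: S a c)).
  by rewrite (sw_counitr (F := fun a => S a c)) //; lin.
apply: eq_tens_lift => a b.
transitivity (\sw_(d, e <- comul b) S a (d * antipode e * c)).
  by rewrite (sw_antipoder (F := fun z => S a (z * c))) ?mul1r //; lin.
by apply: eq_tens_lift => d e'; rewrite mulrA.
Qed.
End Sweedler.

(** Both sides are convolution inverses of the product: along the bijection of [sw_cancel], used
    once in g and once in h, both become ε(g) ε(h) c. *)
Lemma antipodeM (k : fieldType) (H : hopfAlgType k) (g h : H) :
  antipode (g * h) = antipode h * antipode g.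
Proof.
rewrite -[LHS]mulr1 -[RHS]mulr1.
apply: (sw_cancel (T := fun y c => antipode (y * h) * c)
  (T' := fun y c => antipode h * antipode y * c)); try by lin.
move=> y c.
apply: (sw_cancel
  (T := fun x c => \sw_(a, b <- comul y) (antipode (a * x) * (b * c)))
  (T' := fun x c => \sw_(a, b <- comul y) (antipode x * antipode a * (b * c)))); try by lin.
move=> {h c} h c.
transitivity (counit y *: (counit h *: c)).
  rewrite tens_lift_exchange.
  transitivity (\sw_(a, b <- comul (y * h)) (antipode a * b * c)).
    rewrite swM; try by lin.
    by do 2![apply: eq_tens_lift => ? ?]; rewrite !mulrA.
  by rewrite (sw_antipodel (F := fun x => x * c)) ?mul1r ?rmorphM ?scalerA //; lin.
transitivity (\sw_(a, b <- comul h) (counit y *: (antipode a * b * c))).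
  rewrite -(sw_lin (g := fun x => counit y *: x)); try by lin.
  by rewrite (sw_antipodel (F := fun x => x * c)) ?mul1r //; lin.
apply: eq_tens_lift => a b.
transitivity (\sw_(p, q <- comul y) (antipode a * (antipode p * q) * (b * c))).
  by rewrite (sw_antipodel (F := fun x => antipode a * x * (b * c))) ?mulr1 ?mulrA //; lin.
by apply: eq_tens_lift => p q; rewrite !mulrA.
Qed.

(** * The twist of a Frobenius morphism *)

Section Frobenius.
Variables (k : fieldType) (K H : hopfAlgType k) (i : hopf_extension K H).

Lemma inclZ c (a : K) : i (c *: a) = c *: i a.
Proof. exact: linearZ. Qed.

Lemma sw_incl (A : lmodType k) (T : H -> H -> A) (x : K) : bil T ->
  \sw_(a, b <- comul (i x)) T a b = \sw_(c, d <- comul x) T (i c) (i d).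
Proof.
move=> Tb; rewrite incl_comul (sw_sw _ _ Tb); apply: eq_tens_lift => c d.
by rewrite (sw_pure _ _ Tb).
Qed.

(** A Frobenius morphism with its dual bases, as a bare function on H. The bijectivity of h |->
    t((-)h) is recovered from these clauses in [frobenius_system_morphism]. *)
Record frobenius_system n (t : H -> K) (hs ds : 'I_n -> H) : Prop := FrobeniusSystem {
  frob_lin : lin t;
  frobMl : forall a h, t (i a * h) = a * t h;
  frobMr : forall h a, t (h * i a) = t h * a;
  frob_dual_l : forall h, h = \sum_j i (t (h * ds j)) * hs j;
  frob_dual_r : forall h, h = \sum_j ds j * i (t (hs j * h))
}.

Section Twist.
Variables (n : nat) (t : H -> K) (hs ds : 'I_n -> H).
Hypothesis tF : frobenius_system t hs ds.
Let tl : lin t := frob_lin tF.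

(** Nondegeneracy of t survives tensoring with M: since g = Σ t(g ds_j) hs_j, an element Σ g ⊗ m is
    rebuilt from the values at y = ds_j. *)
Lemma frob_nondeg (M : lmodType k) (X Y : vtens H M) :
  (forall y, \sw_(g, m <- X) vpure (t (g * y)) m = \sw_(g, m <- Y) vpure (t (g * y)) m) ->
  X = Y.
Proof.
move=> e; suff main Z : Z = \sum_j \sw_(c, m <- \sw_(g, m <- Z) vpure (t (g * ds j)) m)
    vpure (i c * hs j) m :> vtens H M.
  by rewrite (main X) (main Y); apply: eq_bigr => j _; rewrite e.
rewrite -[LHS]tens_lift_id.
transitivity (\sw_(g, m <- Z) \sum_j vpure (i (t (g * ds j)) * hs j) m).
  apply: eq_tens_lift => g m; rewrite [in LHS](frob_dual_l tF g).
  by apply: (lin_sum (f := fun x : H => vpure x m)); lin.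
rewrite sum_sw; apply: eq_bigr => j _; rewrite sw_sw; try by lin.
by apply: eq_tens_lift => g m; rewrite sw_pure; try by lin.
Qed.

Lemma twist_exists : exists R : vtens H H, forall y,
  \sw_(g, z <- R) \sw_(a, b <- comul y) vpure (t (g * a)) (z * b) =
  \sw_(c, d <- comul (t y)) vpure c (i d).
Proof.
(* As C(yx) = C(y)(x ⊗ 1) for x in K, the dual bases turn C(y) = tr(y_1)_1 ⊗ tr(y_1)_2 S(y_2)
   into the form Σ tr(g y) ⊗ z. *)
pose C y : vtens K H := \sw_(a, b <- comul y) \sw_(c, d <- comul (t a))
  vpure c (i d * antipode b).
have Cl : lin C by rewrite /C; lin.
have CM y x : C (y * i x) = \sw_(c, z <- C y) vpure (c * x) z.
  rewrite /C swM; try by lin.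
  rewrite sw_sw; try by lin.
  apply: eq_tens_lift => a b; rewrite sw_incl; try by lin.
  rewrite sw_sw; try by lin.
  (* By right K-linearity of t, the element x enters only as x_1 ⊗ x_2 S(x_3), which collapses to x
     ⊗ 1. *)
  transitivity (\sw_(p, q <- comul x) \sw_(p1, p2 <- comul p) \sw_(c, d <- comul (t a))
     vpure (c * p1) (i d * (i p2 * antipode (i q)) * antipode b)).
    apply: eq_tens_lift => p q; rewrite (frobMr tF) swM; try by lin.
    rewrite tens_lift_exchange.
    apply: eq_tens_lift => c d; apply: eq_tens_lift => p1 p2.
    by rewrite rmorphM antipodeM !mulrA.
  rewrite -(swA (T := fun p1 p2 q => \sw_(c, d <- comul (t a))
     vpure (c * p1) (i d * (i p2 * antipode (i q)) * antipode b))); try by lin.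
  transitivity (\sw_(p, q <- comul x) (counit q *: \sw_(c, d <- comul (t a))
     vpure (c * p) (i d * antipode b))).
    apply: eq_tens_lift => p q; rewrite -(incl_counit i) /=.
    transitivity (\sw_(a0, b0 <- comul (i q)) \sw_(c, d <- comul (t a))
      vpure (c * p) (i d * (a0 * antipode b0) * antipode b)).
      by rewrite sw_incl; try by lin.
    rewrite (sw_antipoder (F := fun z => \sw_(c, d <- comul (t a))
      vpure (c * p) (i d * z * antipode b))); try by lin.
    by congr (_ *: _); apply: eq_tens_lift => c d; rewrite mulr1.
  rewrite (sw_counitr (F := fun p => \sw_(c, d <- comul (t a))
     vpure (c * p) (i d * antipode b))); try by lin.
  by apply: eq_tens_lift => c d; rewrite sw_pure; try by lin.
(* With c ⊗ z = C(ds_j), the expansion y = Σ ds_j t(hs_j y) gives C(y) = Σ c t(hs_j y) ⊗ z = Σ t(c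
   hs_j y) ⊗ z, from which the witness is read off. *)
exists (\sum_j \sw_(c, z <- C (ds j)) vpure (i c * hs j) z) => y.
rewrite sw_sum; try by lin.
transitivity (\sw_(a, b <- comul y) \sum_j \sw_(c, z <- C (ds j)) vpure (c * t (hs j * a)) (z * b)).
  rewrite sum_sw; apply: eq_bigr => j _.
  rewrite sw_sw; try by lin.
  rewrite tens_lift_exchange; apply: eq_tens_lift => a b.
  rewrite tens_lift_exchange; apply: eq_tens_lift => c z.
  by rewrite sw_pure ?frobMl -?mulrA ?(frobMl tF) //; try by lin.
transitivity (\sw_(a, b <- comul y) \sw_(c, z <- C a) vpure c (z * b)).
  apply: eq_tens_lift => a b; rewrite [in RHS](frob_dual_r tF a) (lin_sum _ _ Cl).
  rewrite sw_sum; try by lin.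
  apply: eq_bigr => j _; rewrite CM [RHS]sw_sw; try by lin.
  by apply: eq_tens_lift => c z; rewrite sw_pure; try by lin.
(* What remains is C(y_1)(1 ⊗ y_2) = Δ(t(y)), where S(y_2) y_3 cancels. *)
transitivity (\sw_(a, b <- comul y) \sw_(p, q <- comul b) \sw_(c, d <- comul (t a))
    vpure c (i d * (antipode p * q))).
  rewrite (swA (T := fun a p q => \sw_(c, d <- comul (t a))
    vpure c (i d * (antipode p * q)))); try by lin.
  apply: eq_tens_lift => a b; rewrite /C sw_sw; try by lin.
  apply: eq_tens_lift => p q; rewrite sw_sw; try by lin.
  by apply: eq_tens_lift => c d; rewrite sw_pure ?mulrA //; try by lin.
transitivity (\sw_(a, b <- comul y) (counit b *: \sw_(c, d <- comul (t a)) vpure c (i d))).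
  apply: eq_tens_lift => a b.
  rewrite (sw_antipodel (F := fun z => \sw_(c, d <- comul (t a)) vpure c (i d * z))); try by lin.
  by congr (_ *: _); apply: eq_tens_lift => c d; rewrite mulr1.
by rewrite (sw_counitr (F := fun a => \sw_(c, d <- comul (t a)) vpure c (i d))); try by lin.
Qed.
End Twist.
End Frobenius.

Lemma counit_sw (k : fieldType) (H : hopfAlgType k) (U V : lmodType k)
  (E : U -> V -> H) (t : vtens U V) :
  counit (\sw_(a, b <- t) E a b) = \sw_(a, b <- t) counit (E a b) :> k.
Proof. exact: (sw_lin _ _ (@lin_counit0 k H)). Qed.

Section Twist.
Variables (k : fieldType) (K H : hopfAlgType k) (i : hopf_extension K H).
Variables (n : nat) (t : H -> K) (hs ds : 'I_n -> H).
Hypothesis tF : frobenius_system i t hs ds.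
Let tl : lin t := frob_lin tF.
Variable R : vtens H H.
Hypothesis hR : forall y,
  \sw_(g, z <- R) \sw_(a, b <- comul y) vpure (t (g * a)) (z * b) =
  \sw_(c, d <- comul (t y)) vpure c (i d) :> vtens K H.

Lemma twist_sw (A : lmodType k) (F : K -> H -> A) y : bil F ->
  \sw_(g, z <- R) \sw_(a, b <- comul y) F (t (g * a)) (z * b) =
  \sw_(c, d <- comul (t y)) F c (i d).
Proof.
move=> Fb; have /(congr1 (fun X => \sw_(c, w <- X) F c w)) := hR y.
rewrite !(sw_sw _ _ Fb) => e; apply: etrans (etrans e _).
  apply: eq_tens_lift => g z; rewrite (sw_sw _ _ Fb).
  by apply: eq_tens_lift => a b; rewrite (sw_pure _ _ Fb).
by apply: eq_tens_lift => c d; rewrite (sw_pure _ _ Fb).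
Qed.

(* Both sides come from Δ applied twice to tr(y), on either factor. *)
Lemma twist_coassoc :
  \sw_(g, z <- R) vpure g (comul z) =
  \sw_(g, z <- R) \sw_(g1, g2 <- comul g) \sw_(l, m <- R)
    vpure (l * g1) (vpure (m * g2) z) :> vtens H (vtens H H).
Proof.
(* [P1] and [P2] are the two sides with t((-)y) in the first factor and b, c multiplied into the
   other two. At y_1, y_2 b, y_3 c both equal t(y)_1 ⊗ t(y)_2 b ⊗ t(y)_3 c. Two uses of [sw_cancel]
   then identify them, and [frob_nondeg] removes y. *)
pose P1 y b c : vtens K (vtens H H) := \sw_(g, z <- R) \sw_(z1, z2 <- comul z)
  vpure (t (g * y)) (vpure (z1 * b) (z2 * c)).
pose P2 y b c : vtens K (vtens H H) := \sw_(g, z <- R) \sw_(g1, g2 <- comul g)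
  \sw_(l, m <- R) vpure (t (l * g1 * y)) (vpure (m * g2 * b) (z * c)).
have main1 y b c : \sw_(a, e <- comul y) \sw_(y1, y2 <- comul a) P1 y1 (y2 * b) (e * c) =
    \sw_(p, d <- comul (t y)) \sw_(d1, d2 <- comul d) vpure p (vpure (i d1 * b) (i d2 * c)).
  rewrite -(swA (T := fun y1 y2 e => P1 y1 (y2 * b) (e * c))); try by rewrite /P1; lin.
  transitivity (\sw_(p, d <- comul (t y)) \sw_(d1, d2 <- comul (i d))
      vpure p (vpure (d1 * b) (d2 * c))); last first.
    by apply: eq_tens_lift => p d; rewrite sw_incl; try by lin.
  rewrite -(twist_sw (F := fun p d => \sw_(d1, d2 <- comul d)
      vpure p (vpure (d1 * b) (d2 * c)))); try by lin.
  rewrite [RHS]tens_lift_exchange; apply: eq_tens_lift => a e.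
  rewrite /P1 tens_lift_exchange; apply: eq_tens_lift => g z.
  rewrite swM; try by lin.
  rewrite tens_lift_exchange.
  by do 2![apply: eq_tens_lift => ? ?]; rewrite !mulrA.
(* The identity defining R is used twice here, for y and then for g y_1, because Δ falls on the
   first factor. *)
have main2 y b c : \sw_(a, e <- comul y) \sw_(y1, y2 <- comul a) P2 y1 (y2 * b) (e * c) =
    \sw_(p, d <- comul (t y)) \sw_(d1, d2 <- comul d) vpure p (vpure (i d1 * b) (i d2 * c)).
  rewrite (swA (T := fun p d1 d2 => vpure p (vpure (i d1 * b) (i d2 * c)))); try by lin.
  rewrite -(twist_sw (F := fun p d => \sw_(p1, p2 <- comul p)
      vpure p1 (vpure (i p2 * b) (d * c)))); try by lin.
  rewrite [RHS]tens_lift_exchange; apply: eq_tens_lift => a e.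
  rewrite /P2 tens_lift_exchange; apply: eq_tens_lift => g z.
  rewrite -(twist_sw (F := fun p d => vpure p (vpure (d * b) (z * e * c)))); try by lin.
  transitivity (\sw_(w1, w2 <- comul (g * a)) \sw_(l, m <- R)
      vpure (t (l * w1)) (vpure (m * w2 * b) (z * e * c))); last first.
    by rewrite tens_lift_exchange.
  rewrite swM; try by lin.
  rewrite tens_lift_exchange.
  by do 3![apply: eq_tens_lift => ? ?]; rewrite !mulrA.
have P12 y b c : P1 y b c = P2 y b c.
  apply: (sw_cancel (T := fun y b => P1 y b c) (T' := fun y b => P2 y b c));
    try by rewrite /P1 /P2; lin.
  move=> {b}{}y b.
  apply: (sw_cancel (T := fun y c => \sw_(y1, y2 <- comul y) P1 y1 (y2 * b) c)
      (T' := fun y c => \sw_(y1, y2 <- comul y) P2 y1 (y2 * b) c));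
    try by rewrite /P1 /P2; lin.
  by move=> {c}{}y c; rewrite main1 main2.
apply: (frob_nondeg tF) => y; have := P12 y 1 1; rewrite /P1 /P2 => e.
rewrite !sw_sw; try by lin.
apply: etrans (etrans e _); apply: eq_tens_lift => g z.
  rewrite sw_pure; try by lin.
  rewrite -[in LHS](tens_lift_id (comul z)).
  rewrite (sw_lin (g := vpure (t (g * y)))); try by lin.
  by apply: eq_tens_lift => ? ?; rewrite !mulr1.
rewrite sw_sw; try by lin.
apply: eq_tens_lift => g1 g2; rewrite sw_sw; try by lin.
apply: eq_tens_lift => l m; rewrite sw_pure; try by lin.
by rewrite !mulr1.
Qed.

Lemma twist_coassoc_sw (A : lmodType k) (T : H -> H -> H -> A) :
  (forall b c, lin (fun a => T a b c)) -> (forall a c, lin (fun b => T a b c)) ->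
  (forall a b, lin (T a b)) ->
  \sw_(g, z <- R) \sw_(z1, z2 <- comul z) T g z1 z2 =
  \sw_(g, z <- R) \sw_(g1, g2 <- comul g) \sw_(l, m <- R) T (l * g1) (m * g2) z.
Proof.
move=> T1 T2 T3.
have ib a : bil (T a) by split=> [c|c]; [exact: T2|exact: T3].
have gb : bil (fun a (t : vtens H H) => \sw_(c, d <- t) T a c d).
  split=> [x|a]; last exact: lin_lift (ib a).
  by apply: lin_swr => c d; exact: T1.
have /(congr1 (tens_lift (fun a (t : vtens H H) => \sw_(c, d <- t) T a c d))) :=
  twist_coassoc.
rewrite !(sw_sw _ _ gb) => e; apply: etrans (etrans e _).
  by apply: eq_tens_lift => g z; rewrite (sw_pure _ _ gb).
apply: eq_tens_lift => g z; rewrite (sw_sw _ _ gb).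
apply: eq_tens_lift => g1 g2; rewrite (sw_sw _ _ gb).
by apply: eq_tens_lift => l m; rewrite (sw_pure _ _ gb) (sw_pure _ _ (ib _)).
Qed.

Definition twist_unit : H := \sw_(g, z <- R) (g * antipode z).
Definition twist_inv : H := \sw_(g, z <- R) (counit g *: z).
Local Notation u := twist_unit.
Local Notation v := twist_inv.

(** Applying 1 ⊗ ε to the identity defining R shows that t(sy) = t(y) for this sum s and all y, and
    t is nondegenerate. *)
Lemma twist_counit : \sw_(g, z <- R) (counit z *: g) = 1.
Proof.
have main y : t ((\sw_(g, z <- R) (counit z *: g)) * y) = t y.
  rewrite (sw_lin (g := fun g => t (g * y))); try by lin.
  transitivity (\sw_(c, d <- comul (t y)) (counit (i d) *: c)).
    rewrite -(twist_sw (F := fun c d => counit d *: c)); try by lin.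
    apply: eq_tens_lift => g z.
    rewrite -scalerAl (linZ tl).
    transitivity (\sw_(a, b <- comul y) (counit b *: (counit z *: t (g * a)))).
      by rewrite (sw_counitr (F := fun a => counit z *: t (g * a))); try by lin.
    by apply: eq_tens_lift => a b; rewrite scalerA rmorphM mulrC.
  rewrite -[RHS](sw_counitr (F := fun c => c)); try by lin.
  by apply: eq_tens_lift => c d; rewrite incl_counit.
rewrite [LHS](frob_dual_l tF) [RHS](frob_dual_l tF).
by apply: eq_bigr => j _; rewrite main mul1r.
Qed.

(** Apply ε to the first factor in the coassociativity of R. Once u v = 1 is known, this is the
    factorization R = (u ⊗ 1)Δ(v). *)
Lemma twist_inv_comul : \sw_(g, z <- R) vpure (v * g) z = comul v.
Proof.
have := twist_coassoc_sw (T := fun a b c => counit a *: vpure b c).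
move=> /(_ _ _ _) e; rewrite [in RHS]/v.
rewrite (sw_lin (g := comul)); try by lin.
transitivity (\sw_(g, z <- R) \sw_(z1, z2 <- comul z) (counit g *: vpure z1 z2)); last first.
  apply: eq_tens_lift => g z; rewrite linearZ /= -[in RHS](tens_lift_id (comul z)).
  by rewrite -(sw_lin (g := fun x => counit g *: x)); try by lin.
rewrite e; try by lin.
apply: eq_tens_lift => g z.
transitivity (\sw_(g1, g2 <- comul g) (counit g1 *: vpure (v * g2) z)).
  by rewrite (sw_counitl (F := fun x => vpure (v * x) z)); try by lin.
apply: eq_tens_lift => g1 g2.
rewrite -(linZ (f := fun x => vpure x z)); try by lin.
rewrite /v (sw_lin (g := fun x => vpure (counit g1 *: (x * g2)) z)); try by lin.
apply: eq_tens_lift => l m; rewrite -scalerAl scalerA.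
by rewrite (linZ (f := fun x => vpure x z)) ?rmorphM ?[counit l * _]mulrC //; lin.
Qed.

(** By [twist_inv_comul], v u = Σ v g S(z) is v_1 S(v_2) = ε(v), and ε(v) = Σ ε(g) ε(z) = 1 by
    [twist_counit]. *)
Lemma twist_invl : v * u = 1.
Proof.
transitivity (\sw_(a, b <- comul v) (a * antipode b)).
  rewrite -twist_inv_comul sw_sw; try by lin.
  rewrite /u (sw_lin (g := fun x => v * x)); try by lin.
  by apply: eq_tens_lift => g z; rewrite sw_pure ?mulrA //; lin.
rewrite antipoder /v.
have -> : counit (\sw_(g, z <- R) (counit g *: z)) = 1.
  rewrite -[RHS](rmorph1 (@counit k H)) -twist_counit counit_sw [RHS]counit_sw.
  by apply: eq_tens_lift => g z; rewrite !linearZ /= mulrC.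
by rewrite scale1r.
Qed.

(** Apply a ⊗ b ⊗ c |-> a S(b) c to the coassociativity of R. One side is Σ g S(z_1) z_2 = Σ ε(z) g
    = 1; the other is Σ l g_1 S(g_2) S(m) z = u v. *)
Lemma twist_invr : u * v = 1.
Proof.
have := twist_coassoc_sw (T := fun a b c => a * antipode b * c).
move=> /(_ _ _ _) e.
transitivity (\sw_(g, z <- R) (counit z *: g)); last exact: twist_counit.
transitivity (\sw_(g, z <- R) \sw_(z1, z2 <- comul z) (g * antipode z1 * z2)); last first.
  apply: eq_tens_lift => g z; rewrite -[in RHS](mulr1 g).
  rewrite -(sw_antipodel (F := fun x => g * x)); try by lin.
  by apply: eq_tens_lift => ? ?; rewrite mulrA.
rewrite e; try by lin.
rewrite [in LHS]/v (sw_lin (g := fun x => u * x)); try by lin.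
apply: eq_tens_lift => g z.
rewrite -scalerAr /u (sw_lin (g := fun x => counit g *: (x * z))); try by lin.
rewrite tens_lift_exchange; apply: eq_tens_lift => l m.
transitivity (\sw_(g1, g2 <- comul g) (l * (g1 * antipode g2) * antipode m * z)).
  by rewrite (sw_antipoder (F := fun x => l * x * antipode m * z)) ?mulr1 //; lin.
by apply: eq_tens_lift => g1 g2; rewrite antipodeM !mulrA.
Qed.

(** R Δ(u) = (u ⊗ 1)Δ(v)Δ(u), and Δ(v)Δ(u) = Δ(v u) = 1 ⊗ 1. *)
Lemma twist_unit_comul :
  \sw_(g, z <- R) \sw_(a, b <- comul u) vpure (g * a) (z * b) = vpure u 1.
Proof.
transitivity (\sw_(p, q <- comul v) \sw_(a, b <- comul u) vpure (u * (p * a)) (q * b)).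
  rewrite -twist_inv_comul sw_sw; try by lin.
  apply: eq_tens_lift => g z; rewrite sw_pure; try by lin.
  by apply: eq_tens_lift => a b; rewrite !mulrA twist_invr mul1r.
rewrite -(swM (T := fun a b => vpure (u * a) b)); try by lin.
by rewrite twist_invl sw1 ?mulr1 //; lin.
Qed.

(** Evaluate the identity defining R at xy. As t(xy) = x t(y), its right side is Δ(x) times the one
    at y. [sw_cancel] and the nondegeneracy of t then remove y. *)
Lemma twist_incl (x : K) :
  \sw_(g, z <- R) \sw_(x1, x2 <- comul x) vpure (g * i x1) (z * i x2) =
  \sw_(g, z <- R) \sw_(x1, x2 <- comul x) vpure (i x1 * g) (i x2 * z).
Proof.
apply: (frob_nondeg tF) => y.
pose P1 y b : vtens K H :=
  \sw_(g, z <- R) \sw_(x1, x2 <- comul x) vpure (t (g * i x1 * y)) (z * i x2 * b).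
pose P2 y b : vtens K H :=
  \sw_(g, z <- R) \sw_(x1, x2 <- comul x) vpure (x1 * t (g * y)) (i x2 * z * b).
have P12 b : P1 y b = P2 y b.
  apply: (sw_cancel (T := P1) (T' := P2)); try by rewrite /P1 /P2; lin.
  move=> {b}{}y b.
  transitivity (\sw_(c, d <- comul (t (i x * y))) vpure c (i d * b)).
    rewrite -(twist_sw (F := fun c d => vpure c (d * b))); try by lin.
    rewrite /P1 [LHS]tens_lift_exchange; apply: eq_tens_lift => g z.
    rewrite swM ?sw_incl; try by lin.
    rewrite tens_lift_exchange.
    by do 2![apply: eq_tens_lift => ? ?]; rewrite !mulrA.
  rewrite (frobMl tF) swM; try by lin.
  transitivity (\sw_(x1, x2 <- comul x) \sw_(g, z <- R) \sw_(a, e <- comul y)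
      vpure (x1 * t (g * a)) (i x2 * (z * e) * b)).
    apply: eq_tens_lift => x1 x2.
    rewrite (twist_sw (F := fun c d => vpure (x1 * c) (i x2 * d * b))); try by lin.
    by apply: eq_tens_lift => c d; rewrite rmorphM.
  rewrite tens_lift_exchange /P2 [RHS]tens_lift_exchange; apply: eq_tens_lift => g z.
  rewrite tens_lift_exchange.
  by do 2![apply: eq_tens_lift => ? ?]; rewrite !mulrA.
have := P12 1; rewrite /P1 /P2 => e.
rewrite !sw_sw; try by lin.
apply: etrans (etrans e _); apply: eq_tens_lift => g z; rewrite sw_sw; try by lin.
  by apply: eq_tens_lift => c d; rewrite sw_pure ?mulr1 //; lin.
by apply: eq_tens_lift => c d; rewrite sw_pure ?mulr1 -?mulrA ?(frobMl tF) //; lin.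
Qed.

(** Applying a ⊗ b |-> a S(b) to [twist_incl] gives ε(x) u = x_1 u S(x_2), whence u x = x_1 u S(x_2)
    x_3 = x u. *)
Lemma twist_unit_comm (x : K) : u * i x = i x * u.
Proof.
have tw y : \sw_(x1, x2 <- comul y) (i x1 * u * antipode (i x2)) = counit y *: u.
  have := twist_incl y => /(congr1 (fun X => \sw_(a, b <- X) (a * antipode b))).
  rewrite !sw_sw; try by lin.
  move=> e; apply: etrans (etrans (esym e) _).
    transitivity (\sw_(g, z <- R) \sw_(x1, x2 <- comul y)
        (i x1 * (g * antipode z) * antipode (i x2))).
      rewrite [RHS]tens_lift_exchange; apply: eq_tens_lift => x1 x2.
      by rewrite /u (sw_lin (g := fun w => i x1 * w * antipode (i x2))); try by lin.
    apply: eq_tens_lift => g z; rewrite sw_sw; try by lin.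
    apply: eq_tens_lift => x1 x2; rewrite sw_pure; try by lin.
    by rewrite antipodeM !mulrA.
  rewrite /u (sw_lin (g := fun w => counit y *: w)); try by lin.
  apply: eq_tens_lift => g z; rewrite sw_sw; try by lin.
  transitivity (\sw_(a, b <- comul (i y)) (g * (a * antipode b) * antipode z)).
    rewrite sw_incl; try by lin.
    apply: eq_tens_lift => x1 x2; rewrite sw_pure; try by lin.
    by rewrite antipodeM !mulrA.
  by rewrite (sw_antipoder (F := fun w => g * w * antipode z)) ?mulr1 ?incl_counit //; lin.
transitivity (\sw_(p, q <- comul x) \sw_(p1, p2 <- comul p)
    (i p1 * u * antipode (i p2) * i q)).
  rewrite -[in LHS](sw_counitl (F := fun y => u * i y)); try by lin.
  apply: eq_tens_lift => p q; rewrite scalerAl -tw.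
  by rewrite (sw_lin (g := fun w => w * i q)); try by lin.
rewrite -(swA (T := fun p1 p2 q => i p1 * u * antipode (i p2) * i q)); try by lin.
rewrite -[in RHS](sw_counitr (F := fun y => i y * u)); try by lin.
apply: eq_tens_lift => p q; rewrite -(incl_counit i).
transitivity (\sw_(a, b <- comul (i q)) (i p * u * (antipode a * b))).
  by rewrite sw_incl; [apply: eq_tens_lift => ? ?; rewrite !mulrA | lin].
by rewrite (sw_antipodel (F := fun w => i p * u * w)) ?mulr1 //; lin.
Qed.

Lemma twist_inv_comm (x : K) : v * i x = i x * v.
Proof.
by rewrite -[RHS]mul1r -twist_invl -!mulrA [u * _]mulrA twist_unit_comm -mulrA twist_invr mulr1.
Qed.

(** Left K-linearity survives because u commutes with K; the unit u inside t is compensated by its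
    inverse v in front of the hs_j. *)
Lemma normalized_frobenius_system :
  frobenius_system i (fun x => t (u * x)) (fun j => v * hs j) ds.
Proof.
split=> [|a h|h a|h|h]; first by lin.
- by rewrite mulrA twist_unit_comm -mulrA (frobMl tF).
- by rewrite mulrA (frobMr tF).
- transitivity (v * \sum_j i (t (u * h * ds j)) * hs j).
    by rewrite -(frob_dual_l tF) mulrA twist_invl mul1r.
  rewrite mulr_sumr; apply: eq_bigr => j _.
  by rewrite mulrA twist_inv_comm !mulrA.
- rewrite [LHS](frob_dual_r tF); apply: eq_bigr => j _.
  by rewrite !mulrA twist_invr mul1r.
Qed.

(** Writing u x_1 ⊗ x_2 = (u ⊗ 1)Δ(x) as R Δ(u)Δ(x) = R Δ(ux) turns the left side into the identity
    defining R at ux. *)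
Lemma normalized_colinear (x : H) :
  \sw_(a, b <- comul x) vpure (t (u * a)) b =
  \sw_(c, d <- comul (t (u * x))) vpure c (i d).
Proof.
rewrite -hR.
have /(congr1 (fun X => \sw_(a, b <- comul x) \sw_(g, z <- X) vpure (t (g * a)) (z * b)))
  := twist_unit_comul.
move=> e; apply: etrans (etrans (esym e) _).
  apply: eq_tens_lift => a b; rewrite sw_pure; try by lin.
  by rewrite mul1r.
transitivity (\sw_(a, b <- comul x) \sw_(g, z <- R) \sw_(p, q <- comul u)
    vpure (t (g * (p * a))) (z * (q * b))).
  apply: eq_tens_lift => a b; rewrite sw_sw; try by lin.
  apply: eq_tens_lift => g z; rewrite sw_sw; try by lin.
  by apply: eq_tens_lift => p q; rewrite sw_pure ?mulrA //; lin.
rewrite [LHS]tens_lift_exchange; apply: eq_tens_lift => g z.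
by rewrite swM; [rewrite tens_lift_exchange | lin].
Qed.
End Twist.

(** * Colinearity on the left *)

Section Colinear.
Variables (k : fieldType) (K H : hopfAlgType k) (i : hopf_extension K H).
Variables (n : nat) (f : H -> K) (hs ds : 'I_n -> H).
Hypothesis fF : frobenius_system i f hs ds.
Let fl : lin f := frob_lin fF.
Hypothesis fC : forall x,
  \sw_(a, b <- comul x) vpure (f a) b = \sw_(c, d <- comul (f x)) vpure c (i d).

Lemma colinear_sw (A : lmodType k) (F : K -> H -> A) x : bil F ->
  \sw_(a, b <- comul x) F (f a) b = \sw_(c, d <- comul (f x)) F c (i d).
Proof.
move=> Fb; have /(congr1 (fun X => \sw_(c, w <- X) F c w)) := fC x.
rewrite !(sw_sw _ _ Fb) => e; apply: etrans (etrans e _).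
  by apply: eq_tens_lift => a b; rewrite (sw_pure _ _ Fb).
by apply: eq_tens_lift => c d; rewrite (sw_pure _ _ Fb).
Qed.

Lemma colinear_left : exists b : H, forall x,
  \sw_(a, c <- comul x) vpure a (f c) = \sw_(c, d <- comul (f x)) vpure (b * i c) d.
Proof.
(* Phi is right K-linear and right H-colinear, as f is; the first property makes it
   x |-> Σ p ⊗ f(wx), and the second forces Σ p ⊗ w = b ⊗ 1. *)
pose Phi x : vtens H K := \sw_(a, c <- comul x) \sw_(p, q <- comul (f c))
  vpure (a * antipode (i p)) q.
have Phil : lin Phi by rewrite /Phi; lin.
have PhiM x y : Phi (x * i y) = \sw_(h, q <- Phi x) vpure h (q * y).
  rewrite /Phi swM; try by lin.
  rewrite sw_sw; try by lin.
  apply: eq_tens_lift => a c; rewrite sw_incl; try by lin.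
  rewrite sw_sw; try by lin.
  (* The element y enters as y_1 S(y_2) ⊗ y_3, which collapses to 1 ⊗ y. *)
  transitivity (\sw_(y1, y2 <- comul y) \sw_(r, s <- comul y2) \sw_(p, q <- comul (f c))
     vpure (a * (i y1 * antipode (i r)) * antipode (i p)) (q * s)).
    apply: eq_tens_lift => y1 y2; rewrite (frobMr fF) swM; try by lin.
    rewrite tens_lift_exchange.
    apply: eq_tens_lift => r s; apply: eq_tens_lift => p q.
    by rewrite rmorphM antipodeM !mulrA.
  rewrite (swA (T := fun y1 r s => \sw_(p, q <- comul (f c))
     vpure (a * (i y1 * antipode (i r)) * antipode (i p)) (q * s))); try by lin.
  transitivity (\sw_(y1, y2 <- comul y) (counit y1 *: \sw_(p, q <- comul (f c))
     vpure (a * antipode (i p)) (q * y2))).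
    apply: eq_tens_lift => y1 s; rewrite -(incl_counit i).
    transitivity (\sw_(a0, b0 <- comul (i y1)) \sw_(p, q <- comul (f c))
      vpure (a * (a0 * antipode b0) * antipode (i p)) (q * s)).
      by rewrite sw_incl; try by lin.
    rewrite (sw_antipoder (F := fun z => \sw_(p, q <- comul (f c))
      vpure (a * z * antipode (i p)) (q * s))); try by lin.
    by congr (_ *: _); apply: eq_tens_lift => p q; rewrite mulr1.
  rewrite (sw_counitl (F := fun s => \sw_(p, q <- comul (f c))
     vpure (a * antipode (i p)) (q * s))); try by lin.
  by apply: eq_tens_lift => p q; rewrite sw_pure; try by lin.
(* Obtained from x = Σ ds_j f(hs_j x): the right K-linearity of [Phi] brings f(hs_j x) out, and q
   f(hs_j x) = f(q hs_j x). *)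
pose P : vtens H H := \sum_j \sw_(h, q <- Phi (ds j)) vpure h (i q * hs j).
have PE x : \sw_(p, w <- P) vpure p (f (w * x)) = Phi x.
  rewrite /P sw_sum; try by lin.
  rewrite [in RHS](frob_dual_r fF x) (lin_sum _ _ Phil); apply: eq_bigr => j _.
  rewrite PhiM sw_sw; try by lin.
  apply: eq_tens_lift => h q; rewrite sw_pure; try by lin.
  by rewrite -mulrA (frobMl fF).
have PhiC x c : \sw_(a, e <- comul x) \sw_(h, q <- Phi a) vpure (vpure h q) (e * c) =
    \sw_(h, q <- Phi x) \sw_(q1, q2 <- comul q) vpure (vpure h q1) (i q2 * c).
  transitivity (\sw_(a, a' <- comul x) \sw_(a2, e <- comul a') \sw_(p, q <- comul (f a2))
      vpure (vpure (a * antipode (i p)) q) (e * c)).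
    rewrite (swA (T := fun a a2 e => \sw_(p, q <- comul (f a2))
      vpure (vpure (a * antipode (i p)) q) (e * c))); try by lin.
    apply: eq_tens_lift => a e; rewrite /Phi sw_sw; try by lin.
    apply: eq_tens_lift => a1 a2; rewrite sw_sw; try by lin.
    by apply: eq_tens_lift => p q; rewrite sw_pure; try by lin.
  rewrite [in RHS]/Phi sw_sw; try by lin.
  apply: eq_tens_lift => a a'.
  rewrite (colinear_sw (F := fun y e => \sw_(p, q <- comul y)
      vpure (vpure (a * antipode (i p)) q) (e * c))); try by lin.
  rewrite -(swA (T := fun p q1 q2 =>
      vpure (vpure (a * antipode (i p)) q1) (i q2 * c))); try by lin.
  rewrite sw_sw; try by lin.
  by apply: eq_tens_lift => p q; rewrite sw_pure; try by lin.
(* In terms of [P], the colinearity of [Phi] reads p ⊗ f(w_1 x_1) ⊗ w_2 x_2 = p ⊗ f(w x_1) ⊗ x_2,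
   and [sw_cancel] removes x_2. *)
pose T1 x e : vtens (vtens H K) H := \sw_(p, w <- P) \sw_(w1, w2 <- comul w)
  vpure (vpure p (f (w1 * x))) (w2 * e).
pose T2 x e : vtens (vtens H K) H := \sw_(p, w <- P) vpure (vpure p (f (w * x))) e.
have T12 x e : T1 x e = T2 x e.
  apply: (sw_cancel (T := T1) (T' := T2)); try by rewrite /T1 /T2; lin.
  move=> {e}{}x e.
  transitivity (\sw_(a, b <- comul x) \sw_(h, q <- Phi a) vpure (vpure h q) (b * e)); last first.
    apply: eq_tens_lift => a b; rewrite -PE sw_sw; try by lin.
    by apply: eq_tens_lift => p w; rewrite sw_pure; try by lin.
  rewrite PhiC -PE sw_sw; try by lin.
  rewrite /T1 [LHS]tens_lift_exchange; apply: eq_tens_lift => p w.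
  rewrite [RHS]sw_pure; try by lin.
  rewrite -(colinear_sw (F := fun c d => vpure (vpure p c) (d * e))); try by lin.
  rewrite swM; try by lin.
  rewrite tens_lift_exchange.
  by do 2![apply: eq_tens_lift => ? ?]; rewrite !mulrA.
(* The only candidate: 1 ⊗ ε applied to P = b ⊗ 1 returns b. *)
pose b := \sw_(p, w <- P) (counit w *: p).
have Pb : P = vpure b 1.
  (* Since w = Σ f(w ds_j) hs_j, summing [E j] at x = ds_j replaces f(w x) by ε(w). It sends [T1] to
     Σ p ⊗ w = P and [T2] to Σ ε(w) p ⊗ 1 = b ⊗ 1. *)
  pose E j (X : vtens (vtens H K) H) : vtens H H := \sw_(Y, e <- X) \sw_(p, y <- Y)
    (counit (i y * hs j) *: vpure p e).
  have El j : lin (E j).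
    by apply: (lin_swl (V := vtens H K) (W := H)) => [e|Y|]; lin.
  have Ep j p y e : E j (vpure (vpure p y) e) = counit (i y * hs j) *: vpure p e.
    rewrite /E (sw_pure (U := vtens H K) (V := H)); try by lin.
    by rewrite sw_pure; try by lin.
  have dualE (w : H) : \sum_j counit (i (f (w * ds j)) * hs j) = counit w.
    by rewrite [in RHS](frob_dual_l fF w) raddf_sum.
  have : \sum_j E j (T1 (ds j) 1) = \sum_j E j (T2 (ds j) 1).
    by apply: eq_bigr => j _; rewrite T12.
  have -> : \sum_j E j (T1 (ds j) 1) = P.
    transitivity (\sw_(p, w <- P) \sw_(w1, w2 <- comul w) \sum_j
        (counit (i (f (w1 * ds j)) * hs j) *: vpure p w2)); last first.
      rewrite -[RHS]tens_lift_id; apply: eq_tens_lift => p w.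
      transitivity (\sw_(w1, w2 <- comul w) (counit w1 *: vpure p w2)).
        by apply: eq_tens_lift => w1 w2; rewrite -scaler_suml dualE.
      by apply: (sw_counitl (F := fun w : H => vpure p w)); lin.
    under [RHS]eq_tens_lift do rewrite sum_sw.
    rewrite sum_sw; apply: eq_bigr => j _; rewrite /T1 (sw_lin _ _ (El j)).
    apply: eq_tens_lift => p w; rewrite (sw_lin _ _ (El j)).
    by apply: eq_tens_lift => w1 w2; rewrite Ep mulr1.
  move=> ->.
  transitivity (\sw_(p, w <- P) \sum_j
        (counit (i (f (w * ds j)) * hs j) *: vpure p 1) : vtens H H).
    rewrite sum_sw; apply: eq_bigr => j _; rewrite /T2 (sw_lin _ _ (El j)).
    by apply: eq_tens_lift => p w; rewrite Ep.
  rewrite /b (sw_lin (g := fun x => vpure x 1)); try by lin.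
  apply: eq_tens_lift => p w.
  by rewrite -scaler_suml dualE (linZ (f := fun x => vpure x 1)) //; lin.
exists b => x.
(* Now Phi(x) = b ⊗ f(x). The map h ⊗ q |-> h q_1 ⊗ q_2 sends it to the right side, and undoes the
   antipode in the definition of [Phi] to give the left side. *)
transitivity (\sw_(h, q <- Phi x) \sw_(q1, q2 <- comul q) vpure (h * i q1) q2); last first.
  rewrite -PE Pb sw_sw; try by lin.
  rewrite sw_pure; try by lin.
  by rewrite mul1r sw_pure //; lin.
rewrite /Phi sw_sw; try by lin.
apply: eq_tens_lift => a c; rewrite sw_sw; try by lin.
transitivity (\sw_(p, q <- comul (f c)) \sw_(q1, q2 <- comul q)
    vpure (a * (antipode (i p) * i q1)) q2); last first.
  apply: eq_tens_lift => p q; rewrite sw_pure; try by lin.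
  by apply: eq_tens_lift => q1 q2; rewrite mulrA.
rewrite (swA (T := fun p q1 q2 => vpure (a * (antipode (i p) * i q1)) q2)); try by lin.
rewrite -[LHS](sw_counitl (F := fun y => vpure a y)); try by lin.
apply: eq_tens_lift => p q; rewrite -(incl_counit i).
transitivity (\sw_(r, s <- comul (i p)) vpure (a * (antipode r * s)) q).
  by rewrite (sw_antipodel (F := fun z => vpure (a * z) q)) ?mulr1 //; lin.
by rewrite sw_incl; try by lin.
Qed.
End Colinear.

(** * The lax and oplax structures *)

Lemma morphD_comp (A B C : zmodType) (F : B -> C) (G : A -> B) :
  {morph F : x y / x + y} -> {morph G : x y / x + y} ->
  {morph (fun x => F (G x)) : x y / x + y}.
Proof. by move=> FD GD x y; rewrite GD FD. Qed.

Section Frobenius.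
Variables (k : fieldType) (K H : hopfAlgType k) (i : hopf_extension K H).
Variables (n : nat) (f : H -> K) (hs ds : 'I_n -> H).
Hypothesis fF : frobenius_system i f hs ds.
Let fl : lin f := frob_lin fF.

Section Trace.
Variable V : lmodType K.

Lemma ind_trace_balanced : balanced (fun (h : H) (a : K) => h * i a)
  (fun (a : K) (v : V) => a *: v) (fun h v => f h *: v).
Proof.
split=> [v h h'|h v v'|h a v] /=.
- by rewrite (linD fl) scalerDl.
- by rewrite scalerDr.
- by rewrite (frobMr fF) scalerA.
Qed.
Definition ind_trace (z : ind i V) : V := \sw_(h, v <- z) (f h *: v).
Lemma ind_traceD : {morph ind_trace : x y / x + y}.
Proof. exact: tens_liftD ind_trace_balanced. Qed.
Lemma ind_trace0 : ind_trace 0 = 0.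
Proof. by apply: (addrI (ind_trace 0)); rewrite -ind_traceD !addr0. Qed.
Lemma ind_trace_pure h v : ind_trace (ipure i h v) = f h *: v.
Proof. exact: tens_lift_pure ind_trace_balanced. Qed.
Lemma ind_traceZ a z : ind_trace (i a *: z) = a *: ind_trace z.
Proof.
move: z; apply: ind_ext => [x y|x y|h v]; rewrite ?scalerDr ?ind_traceD ?scalerDr //.
by rewrite ind_scale_pureE !ind_trace_pure (frobMl fF) scalerA.
Qed.
(** In h ⊗ v expand h = Σ ds_j f(hs_j h) and move f(hs_j h) across the tensor sign. *)
Lemma ind_trace_recover z : z = \sum_j ipure i (ds j) (ind_trace (hs j *: z)).
Proof.
move: z; apply: ind_ext => [x y|x y|h v] //.
  by rewrite -big_split; apply: eq_bigr => j _; rewrite scalerDr ind_traceD ipureDr.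
rewrite [in LHS](frob_dual_r fF h).
rewrite (big_morph (fun h => ipure i h v) (balDl (ipure_balanced i V) v) (bal0l (ipure_balanced i V) v)).
by apply: eq_bigr => j _; rewrite ind_scale_pureE ind_trace_pure ipureZ.
Qed.
End Trace.

Lemma ind_trace_imap (V W : lmodType K) (g : {linear V -> W}) z :
  ind_trace (imap i g z) = g (ind_trace z).
Proof.
move: z; apply: ind_ext => [x y|x y|h v]; try by rewrite !(linearD, ind_traceD).
by rewrite imap_pure !ind_trace_pure linearZ.
Qed.

(* The Frobenius property makes Ind right adjoint to restriction, with counit
   [ind_trace]; [coext psi] is the transpose of psi. *)
Section Coext.
Variables (X : lmodType H) (M : lmodType K) (psi : X -> M).
Hypotheses (psiD : {morph psi : x y / x + y})
  (psiZ : forall a x, psi (i a *: x) = a *: psi x).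

Let psi_sum I (r : seq I) (E : I -> X) : psi (\sum_(j <- r) E j) = \sum_(j <- r) psi (E j).
Proof.
apply: (big_morph psi psiD); apply: (addrI (psi 0)).
by rewrite -psiD !addr0.
Qed.

Definition coext_fun (x : X) : ind i M := \sum_j ipure i (ds j) (psi (hs j *: x)).

Lemma ind_trace_coext_fun h x : ind_trace (h *: coext_fun x) = psi (h *: x).
Proof.
rewrite /coext_fun scaler_sumr (big_morph _ (@ind_traceD M) (ind_trace0 M)).
rewrite [in RHS](frob_dual_l fF h) scaler_suml psi_sum.
apply: eq_bigr => j _; rewrite ind_scale_pureE ind_trace_pure.
by rewrite -scalerA psiZ.
Qed.
(** By [ind_trace_recover] it is enough to compare the values of θ(hs_j -), and θ(h coext(x)) =
    psi(hx) holds for every h in H. *)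
Lemma coext_linear : linear coext_fun.
Proof.
move=> h x y; rewrite [RHS]ind_trace_recover; apply: eq_bigr => j _.
by rewrite !scalerDr ind_traceD psiD !scalerA !ind_trace_coext_fun.
Qed.
Definition coext : {linear X -> ind i M} := mklin coext_linear.
Lemma coextE x : coext x = \sum_j ipure i (ds j) (psi (hs j *: x)).
Proof. by []. Qed.
Lemma ind_trace_coext x : ind_trace (coext x) = psi x.
Proof. by rewrite -[coext x]scale1r ind_trace_coext_fun scale1r. Qed.
End Coext.

(** The uniqueness half of the adjunction; linearity carries the hs_j of [ind_trace_recover] inside
    the two maps. *)
Lemma coext_ext (X : lmodType H) (M : lmodType K) (alpha beta : {linear X -> ind i M}) :
  (forall x, ind_trace (alpha x) = ind_trace (beta x)) -> alpha = beta.
Proof.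
move=> e; apply: linear_ext => x.
rewrite [LHS]ind_trace_recover [RHS]ind_trace_recover.
by apply: eq_bigr => j _; rewrite -!linearZ e.
Qed.

Lemma incl_scalar (c : k) : c%:A = i c%:A :> H.
Proof. by rewrite inclZ rmorph1. Qed.

Section Lax.
Variables V U : lmodType K.
Lemma trace2_balanced : balanced (@sratk k H (ind i V)) (@slatk k H (ind i U))
  (fun s s' => mpure (ind_trace s) (ind_trace s')).
Proof.
split=> [s x y|s x y|s c s'] /=; rewrite ?ind_traceD ?mpureDl ?mpureDr //.
by rewrite /sratk /slatk incl_scalar !ind_traceZ mpureZ.
Qed.
Definition trace2 (z : mtens (ind i V) (ind i U)) : mtens V U :=
  \sw_(s, s' <- z) mpure (ind_trace s) (ind_trace s').
Lemma trace2D : {morph trace2 : x y / x + y}.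
Proof. exact: tens_liftD trace2_balanced. Qed.
Lemma trace2_pure s s' : trace2 (mpure s s') = mpure (ind_trace s) (ind_trace s').
Proof. exact: tens_lift_pure trace2_balanced. Qed.
Lemma trace2Z a z : trace2 (i a *: z) = a *: trace2 z.
Proof.
move: z; apply: mtens_ext => [x y|x y|s s'].
- by rewrite scalerDr trace2D.
- by rewrite trace2D scalerDr.
rewrite trace2_pure !mtens_scale_pure incl_comul.
rewrite (tens_lift_comp _ _ (tens_liftD (act_pure_balanced s s'))).
rewrite (tens_lift_comp _ _ trace2D); apply: eq_tens_lift => b c.
rewrite (tens_lift_pure _ _ (act_pure_balanced s s')) trace2_pure.
by rewrite !ind_traceZ.
Qed.
Definition ind_lax_map : {linear mtens (ind i V) (ind i U) -> ind i (mtens V U)} :=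
  coext trace2D trace2Z.
Lemma ind_trace_lax z : ind_trace (ind_lax_map z) = trace2 z.
Proof. exact: ind_trace_coext. Qed.
End Lax.

(** Both trivial modules have carrier k; the transpose of this identity is the unit of the lax
    structure. *)
Definition unit_id (c : munit H) : munit K := c.
Lemma unit_idD : {morph unit_id : x y / x + y}. Proof. by []. Qed.
Lemma unit_idZ a c : unit_id (i a *: c) = a *: unit_id c.
Proof. by rewrite !munit_scaleE incl_counit. Qed.
Definition ind_lax0 : {linear munit H -> ind i (munit K)} := coext unit_idD unit_idZ.

(** This law and the next three are compared after θ, where each lax map becomes θ ⊗ θ and pure
    tensors can be followed. *)
Lemma ind_lax_nat (V V' U U' : lmodType K) (g : {linear V -> V'}) (g' : {linear U -> U'}) :
  lcomp (imap i (mmap g g')) (ind_lax_map V U) =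
  lcomp (ind_lax_map V' U') (mmap (imap i g) (imap i g')).
Proof.
apply: coext_ext => z; rewrite !lcompE ind_trace_imap !ind_trace_lax; move: z.
apply: mtens_ext => [||s s'].
- exact: (morphD_comp (linearD (mmap g g')) (@trace2D V U)).
- exact: (morphD_comp (@trace2D V' U') (linearD (mmap (imap i g) (imap i g')))).
by rewrite trace2_pure !mmap_pure trace2_pure !ind_trace_imap.
Qed.

Lemma ind_lax_assoc (V U W : lmodType K) :
  lcomp (lcomp (imap i (massoc V U W)) (ind_lax_map (mtens V U) W))
    (mmap (ind_lax_map V U) idfun) =
  lcomp (lcomp (ind_lax_map V (mtens U W)) (mmap idfun (ind_lax_map U W)))
    (massoc (ind i V) (ind i U) (ind i W)).
Proof.
apply: coext_ext => z; rewrite !lcompE ind_trace_imap !ind_trace_lax; move: z.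
apply: mtens3_ext => [||s s' s''].
- apply: (morphD_comp (linearD (massoc V U W))); apply: (morphD_comp (@trace2D _ _)).
  exact: (linearD (mmap (ind_lax_map V U) idfun)).
- apply: (morphD_comp (@trace2D _ _)).
  exact: (linearD (lcomp (mmap idfun (ind_lax_map U W)) (massoc (ind i V) (ind i U) (ind i W)))).
rewrite massoc_pure !mmap_pure !trace2_pure !ind_trace_lax !trace2_pure.
by rewrite massoc_pure.
Qed.

Lemma ind_lax_unitl (V : lmodType K) :
  lcomp (lcomp (imap i (lunit V)) (ind_lax_map (munit K) V)) (mmap ind_lax0 idfun) =
  lunit (ind i V).
Proof.
apply: coext_ext => z; rewrite !lcompE ind_trace_imap !ind_trace_lax; move: z.
apply: mtens_ext => [||c s].
- apply: (morphD_comp (linearD (lunit V))); apply: (morphD_comp (@trace2D _ _)).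
  exact: (linearD (mmap ind_lax0 idfun)).
- exact: (morphD_comp (@ind_traceD V) (linearD (lunit (ind i V)))).
rewrite mmap_pure trace2_pure !lunit_pure ind_trace_coext.
by rewrite incl_scalar ind_traceZ.
Qed.

Lemma ind_lax_unitr (V : lmodType K) :
  lcomp (lcomp (imap i (runit V)) (ind_lax_map V (munit K))) (mmap idfun ind_lax0) =
  runit (ind i V).
Proof.
apply: coext_ext => z; rewrite !lcompE ind_trace_imap !ind_trace_lax; move: z.
apply: mtens_ext => [||s c].
- apply: (morphD_comp (linearD (runit V))); apply: (morphD_comp (@trace2D _ _)).
  exact: (linearD (mmap idfun ind_lax0)).
- exact: (morphD_comp (@ind_traceD V) (linearD (runit (ind i V)))).
rewrite mmap_pure trace2_pure !runit_pure ind_trace_coext.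
by rewrite incl_scalar ind_traceZ.
Qed.

Definition ind_lax_structure : lax_structure (Ind i) :=
  @LaxStructure (mod_moncat K) (mod_moncat H) (Ind i) (fun V U => ind_lax_map V U) ind_lax0
    ind_lax_nat ind_lax_assoc ind_lax_unitl ind_lax_unitr.
End Frobenius.

(** * The oplax structure, by the adjunction on the other side *)

Section Oplax.
Variables (k : fieldType) (K H : hopfAlgType k) (i : hopf_extension K H).

Section Ext.
Variables (X : lmodType H) (M : lmodType K) (phi : M -> X).
Hypotheses (phiD : {morph phi : x y / x + y})
  (phiZ : forall a x, phi (a *: x) = i a *: phi x).

Lemma ext_balanced : balanced (fun (h : H) (a : K) => h * i a)
  (fun (a : K) (m : M) => a *: m) (fun h m => h *: phi m).
Proof.
by split=> [m h h'|h m m'|h a m] /=; rewrite ?scalerDl ?phiD ?scalerDr // phiZ scalerA.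
Qed.
(** Ind is left adjoint to restriction, with unit η = [ind_in]; this is the transpose of phi. The
    oplax maps are the transposes of η ⊗ η, and their laws are checked on the image of η. *)
Definition ext_fun (z : ind i M) : X := \sw_(h, m <- z) (h *: phi m).
Lemma ext_funD : {morph ext_fun : x y / x + y}.
Proof. exact: tens_liftD ext_balanced. Qed.
Lemma ext_fun_pure h m : ext_fun (ipure i h m) = h *: phi m.
Proof. exact: tens_lift_pure ext_balanced. Qed.
Lemma ext_linear : linear ext_fun.
Proof.
move=> h x y; rewrite (ext_funD (h *: x) y); congr (_ + _); move: x.
apply: ind_ext => [x x'|x x'|g m].
- by rewrite scalerDr ext_funD.
- by rewrite ext_funD scalerDr.
by rewrite ind_scale_pureE !ext_fun_pure scalerA.
Qed.
Definition ext : {linear ind i M -> X} := mklin ext_linear.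
Lemma ext_pure h m : ext (ipure i h m) = h *: phi m.
Proof. exact: ext_fun_pure. Qed.
End Ext.

Lemma ind_hom_ext (X : lmodType H) (M : lmodType K) (alpha beta : {linear ind i M -> X}) :
  (forall m, alpha (ipure i 1 m) = beta (ipure i 1 m)) -> alpha = beta.
Proof.
move=> e; apply: linear_ext; apply: ind_ext => [||h m]; try exact: linearD.
by rewrite -[h]mulr1 -ind_scale_pureE !linearZ e.
Qed.

Definition ind_in (M : lmodType K) (m : M) : ind i M := ipure i 1 m.
Lemma ind_inD (M : lmodType K) : {morph @ind_in M : x y / x + y}.
Proof. exact: ipureDr. Qed.
Lemma ind_inZ (M : lmodType K) a (m : M) : ind_in (a *: m) = i a *: ind_in m.
Proof. by rewrite /ind_in ind_scale_pureE -ipureZ mul1r mulr1. Qed.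

Section Oplax2.
Variables V U : lmodType K.
Lemma in2_balanced : balanced (@sratk k K V) (@slatk k K U)
  (fun v u => mpure (ind_in v) (ind_in u)).
Proof.
split=> [v x y|v x y|v c u] /=; rewrite ?ind_inD ?mpureDl ?mpureDr //.
by rewrite /sratk /slatk !ind_inZ -incl_scalar mpureZ.
Qed.
Definition in2 (z : mtens V U) : mtens (ind i V) (ind i U) :=
  \sw_(v, u <- z) mpure (ind_in v) (ind_in u).
Lemma in2D : {morph in2 : x y / x + y}.
Proof. exact: tens_liftD in2_balanced. Qed.
Lemma in2_pure v u : in2 (mpure v u) = mpure (ind_in v) (ind_in u).
Proof. exact: tens_lift_pure in2_balanced. Qed.
Lemma in2Z a z : in2 (a *: z) = i a *: in2 z.
Proof.
move: z; apply: mtens_ext => [x y|x y|v u].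
- by rewrite scalerDr in2D.
- by rewrite in2D scalerDr.
rewrite in2_pure !mtens_scale_pure incl_comul.
rewrite (tens_lift_comp _ _ (tens_liftD (act_pure_balanced (ind_in v) (ind_in u)))).
rewrite (tens_lift_comp _ _ in2D); apply: eq_tens_lift => b c.
rewrite (tens_lift_pure _ _ (act_pure_balanced (ind_in v) (ind_in u))) in2_pure.
by rewrite !ind_inZ.
Qed.
Definition ind_oplax_map : {linear ind i (mtens V U) -> mtens (ind i V) (ind i U)} :=
  ext in2D in2Z.
Lemma ind_oplax_in z : ind_oplax_map (ind_in z) = in2 z.
Proof. by rewrite [LHS]ext_pure scale1r. Qed.
Lemma ind_oplax_pure h v u : ind_oplax_map (ipure i h (mpure v u)) =
  \sw_(a, b <- comul h) mpure (ipure i a v) (ipure i b u).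
Proof.
rewrite [LHS]ext_pure in2_pure mtens_scale_pure; apply: eq_tens_lift => a b.
by rewrite /ind_in !ind_scale_pureE !mulr1.
Qed.
End Oplax2.

Definition id_unit (c : munit K) : munit H := c.
Lemma id_unitD : {morph id_unit : x y / x + y}. Proof. by []. Qed.
Lemma id_unitZ a c : id_unit (a *: c) = i a *: id_unit c.
Proof. by rewrite !munit_scaleE incl_counit. Qed.
Definition ind_oplax0 : {linear ind i (munit K) -> munit H} := ext id_unitD id_unitZ.

Lemma imap_in (V W : lmodType K) (g : {linear V -> W}) v :
  imap i g (ind_in v) = ind_in (g v).
Proof. exact: imap_pure. Qed.

Lemma ind_oplax_nat (V V' U U' : lmodType K) (g : {linear V -> V'}) (g' : {linear U -> U'}) :
  lcomp (ind_oplax_map V' U') (imap i (mmap g g')) =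
  lcomp (mmap (imap i g) (imap i g')) (ind_oplax_map V U).
Proof.
apply: ind_hom_ext => z.
rewrite !lcompE imap_in !ind_oplax_in; move: z; apply: mtens_ext => [||v u].
- exact: (morphD_comp (@in2D _ _) (linearD (mmap g g'))).
- exact: (morphD_comp (linearD (mmap (imap i g) (imap i g'))) (@in2D _ _)).
by rewrite in2_pure !mmap_pure in2_pure !imap_in.
Qed.

Lemma ind_oplax_assoc (V U W : lmodType K) :
  lcomp (lcomp (massoc (ind i V) (ind i U) (ind i W)) (mmap (ind_oplax_map V U) idfun))
    (ind_oplax_map (mtens V U) W) =
  lcomp (lcomp (mmap idfun (ind_oplax_map U W)) (ind_oplax_map V (mtens U W)))
    (imap i (massoc V U W)).
Proof.
apply: ind_hom_ext => z.
rewrite !lcompE imap_in !ind_oplax_in; move: z; apply: mtens3_ext => [||v u w].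
- apply: (morphD_comp (linearD (massoc _ _ _))).
  exact: (morphD_comp (linearD (mmap (ind_oplax_map V U) idfun)) (@in2D _ _)).
- apply: (morphD_comp (linearD (mmap idfun (ind_oplax_map U W)))).
  exact: (morphD_comp (@in2D _ _) (linearD (massoc V U W))).
rewrite massoc_pure !in2_pure !mmap_pure !ind_oplax_in !in2_pure.
by rewrite massoc_pure.
Qed.

Lemma ind_oplax0_in c : ind_oplax0 (ind_in c) = c.
Proof. by rewrite [LHS]ext_pure scale1r. Qed.

Lemma ind_oplax_unitl (V : lmodType K) :
  lcomp (lcomp (lunit (ind i V)) (mmap ind_oplax0 idfun)) (ind_oplax_map (munit K) V) =
  imap i (lunit V).
Proof.
apply: ind_hom_ext => z.
rewrite !lcompE imap_in !ind_oplax_in; move: z; apply: mtens_ext => [||c v].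
- apply: (morphD_comp (linearD (lunit _))).
  exact: (morphD_comp (linearD (mmap ind_oplax0 idfun)) (@in2D _ _)).
- exact: (morphD_comp (@ind_inD _) (linearD (lunit V))).
rewrite in2_pure mmap_pure !lunit_pure ind_oplax0_in.
by rewrite ind_inZ -incl_scalar.
Qed.

Lemma ind_oplax_unitr (V : lmodType K) :
  lcomp (lcomp (runit (ind i V)) (mmap idfun ind_oplax0)) (ind_oplax_map V (munit K)) =
  imap i (runit V).
Proof.
apply: ind_hom_ext => z.
rewrite !lcompE imap_in !ind_oplax_in; move: z; apply: mtens_ext => [||v c].
- apply: (morphD_comp (linearD (runit _))).
  exact: (morphD_comp (linearD (mmap idfun ind_oplax0)) (@in2D _ _)).
- exact: (morphD_comp (@ind_inD _) (linearD (runit V))).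
rewrite in2_pure mmap_pure !runit_pure ind_oplax0_in.
by rewrite ind_inZ -incl_scalar.
Qed.

Definition ind_oplax_structure : oplax_structure (Ind i) :=
  @OplaxStructure (mod_moncat K) (mod_moncat H) (Ind i) (fun V U => ind_oplax_map V U)
    ind_oplax0 ind_oplax_nat ind_oplax_assoc ind_oplax_unitl ind_oplax_unitr.
End Oplax.

(** * The Frobenius relations *)

Lemma bal0r (R : Type) (M N A : zmodType) (ra : M -> R -> M) (la : R -> N -> N)
  (F : M -> N -> A) : balanced ra la F -> forall m, F m 0 = 0.
Proof. by move=> h m; apply: (addrI (F m 0)); rewrite -(balDr h) !addr0. Qed.

Section BalancedSweedler.
Variables (k : fieldType) (U V : lmodType k) (A : zmodType) (F : U -> V -> A).
Hypothesis Fb : balanced (fun (u : U) (c : k) => c *: u) (fun (c : k) (v : V) => c *: v) F.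

Lemma bal_sw_pure u v : \sw_(a, b <- vpure u v) F a b = F u v.
Proof. exact: tens_lift_pure Fb. Qed.
Lemma bal_sw_sw (W X : lmodType k) (E : W -> X -> vtens U V) (t : vtens W X) :
  \sw_(u, v <- \sw_(w, x <- t) E w x) F u v = \sw_(w, x <- t) \sw_(u, v <- E w x) F u v.
Proof. by rewrite (tens_lift_comp _ _ (tens_liftD Fb)). Qed.
End BalancedSweedler.

(** * Expressing h ⊗ 1 and 1 ⊗ h through coproducts *)

Section AntipodeInverse.
Variables (k : fieldType) (H : hopfAlgType k).

Lemma sw_antipode_split (h : H) :
  \sw_(a, c <- comul h) \sw_(c1, c2 <- comul c) vpure (antipode a * c1) c2 = vpure 1 h.
Proof.
rewrite (swA (T := fun a c1 c2 => vpure (antipode a * c1) c2)); try by lin.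
rewrite -[RHS](sw_counitl (F := fun y => vpure 1 y)); try by lin.
apply: eq_tens_lift => a c.
by rewrite (sw_antipodel (F := fun y => vpure y c)); try by lin.
Qed.

Variable S' : H -> H.
Hypothesis S'K : cancel S' antipode.

Lemma antipode_inv_lin : lin S'.
Proof.
have Si : injective (@antipode k H) by exact: bij_inj antipode_bij.
by move=> c x y; apply: Si; rewrite linearP !S'K.
Qed.
Let S'l := antipode_inv_lin.

(** The point is S'(c_2) c_1 = ε(c): the antipode turns the left side into S(c_1) c_2, and it is
    injective. *)
Lemma sw_antipode_inv_split (h : H) :
  \sw_(a, c <- comul h) \sw_(a1, a2 <- comul a) vpure a1 (S' c * a2) = vpure h 1.
Proof.
have Si : injective (@antipode k H) by exact: bij_inj antipode_bij.
have S1 : antipode 1 = 1 :> H.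
  by have := antipodel (1 : H); rewrite sw1 ?mulr1 ?rmorph1 ?scale1r //; lin.
rewrite -(swA (T := fun a1 a2 c => vpure a1 (S' c * a2))); try by lin.
rewrite -[RHS](sw_counitr (F := fun y => vpure y 1)); try by lin.
apply: eq_tens_lift => a c.
rewrite -(sw_lin (g := fun y => vpure a y)); try by lin.
rewrite -(linZ (f := fun y => vpure y 1)); try by lin.
have -> : vpure (counit c *: a) 1 = vpure a ((counit c)%:A) :> vtens H H.
  by rewrite (linZ (f := fun y => vpure y 1)) ?(linZ (f := fun y => vpure a y)) //; lin.
congr vpure; apply: Si; rewrite linearZ /= S1 -antipodel.
rewrite (sw_lin (g := antipode)); try by lin.
by apply: eq_tens_lift => c1 c2; rewrite antipodeM S'K.
Qed.
End AntipodeInverse.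

Section FrobeniusMonoidal.
Variables (k : fieldType) (K H : hopfAlgType k) (i : hopf_extension K H).
Variables (n : nat) (f : H -> K) (hs ds : 'I_n -> H).
Hypothesis fF : frobenius_system i f hs ds.
Hypothesis fC : forall x,
  \sw_(a, b <- comul x) vpure (f a) b = \sw_(c, d <- comul (f x)) vpure c (i d).
Let fl : lin f := frob_lin fF.

(** The factors are modules over different algebras, so the tensor product over k is kept as an
    abelian group; it serves only as the target of θ ⊗ 1. *)
Definition tensKH (M : lmodType K) (N : lmodType H) : zmodType :=
  tens (@sratk k K M) (@slatk k H N).
Definition tensHK (N : lmodType H) (M : lmodType K) : zmodType :=
  tens (@sratk k H N) (@slatk k K M).

Lemma mact2M (V U : lmodType H) (a b c d : H) (z : mtens V U) :
  mact2 a b (mact2 c d z) = mact2 (a * c) (b * d) z.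
Proof.
move: z; apply: mtens_ext => [x y|x y|v u].
- exact: (morphD_comp (mact2D a b) (mact2D c d)).
- exact: mact2D.
by rewrite !mact2_pure !scalerA.
Qed.

Section Left.
Variables (M : lmodType K) (N : lmodType H).

Lemma tracel_balanced : balanced (@sratk k H (ind i M)) (@slatk k H N)
  (fun s y => tens_pure (@sratk k K M) (@slatk k H N) (ind_trace f s) y).
Proof.
have hb := tens_pure_balanced (@sratk k K M) (@slatk k H N).
split=> [y s s'|s y y'|s c y] /=.
- by rewrite (ind_traceD fF) (balDl hb).
- by rewrite (balDr hb).
- by rewrite /sratk (incl_scalar i) (ind_traceZ fF) -(balZ hb).
Qed.
Definition tracel (z : mtens (ind i M) N) : tensKH M N :=
  \sw_(s, y <- z) tens_pure _ _ (ind_trace f s) y.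
Lemma tracelD : {morph tracel : x y / x + y}.
Proof. exact: tens_liftD tracel_balanced. Qed.
Lemma tracel_pure s y : tracel (mpure s y) = tens_pure _ _ (ind_trace f s) y.
Proof. exact: tens_lift_pure tracel_balanced. Qed.

Lemma actl_balanced (b : H) : balanced (@sratk k K M) (@slatk k H N)
  (fun m y => tens_pure (@sratk k K M) (@slatk k H N) m (b *: y)).
Proof.
have hb := tens_pure_balanced (@sratk k K M) (@slatk k H N).
split=> [y s s'|s y y'|s c y] /=; rewrite ?scalerDr ?(balDl hb) ?(balDr hb) //.
by rewrite (balZ hb) /slatk !scalerA scalA_comm.
Qed.
Lemma tracel_act b z : tracel (mact2 1 b z) = \sw_(m, y <- tracel z) tens_pure _ _ m (b *: y).
Proof.
move: z; apply: mtens_ext => [||s y].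
- exact: (morphD_comp tracelD (mact2D 1 b)).
- exact: (morphD_comp (tens_liftD (actl_balanced b)) tracelD).
rewrite mact2_pure !tracel_pure scale1r.
by rewrite [RHS](tens_lift_pure _ _ (actl_balanced b)).
Qed.

Lemma unl_balanced (d : H) : balanced (@sratk k K M) (@slatk k H N)
  (fun m y => mpure (ipure i d m) y).
Proof.
split=> [y s s'|s y y'|s c y] /=; rewrite ?ipureDr ?mpureDl ?mpureDr //.
by rewrite /sratk /slatk -mpureZ -ipureZ -(incl_scalar i) scalA_comm -ind_scale_pureE.
Qed.
(** This is [ind_trace_recover] in the first factor. It uses the action of hs_j ⊗ 1, which is not
    the diagonal one; [mtens_sepl] bridges that gap. *)
Lemma tracel_recover z :
  z = \sum_j \sw_(m, y <- tracel (mact2 (hs j) 1 z)) mpure (ipure i (ds j) m) y.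
Proof.
move: z; apply: mtens_ext => [//|x y|s y].
  rewrite -big_split; apply: eq_bigr => j _.
  by rewrite (mact2D _ _ x y) (tracelD (mact2 _ _ x)) (tens_liftD (unl_balanced (ds j))).
rewrite [in LHS](ind_trace_recover fF s).
rewrite (big_morph (fun s => mpure s y) (fun s s' => mpureDl s s' y)
  (bal0l (mpure_balanced _ _) y)).
apply: eq_bigr => j _; rewrite mact2_pure scale1r tracel_pure.
by rewrite [RHS](tens_lift_pure _ _ (unl_balanced (ds j))).
Qed.

(* H also acts on the factor Ind M alone, through h ⊗ 1 = (1 ⊗ S^-1(h_2)) Δ(h_1). *)
Lemma mtens_sepl (X : lmodType H) (alpha beta : {linear X -> mtens (ind i M) N}) :
  (forall x, tracel (alpha x) = tracel (beta x)) -> alpha = beta.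
Proof.
move=> e; apply: linear_ext => x; rewrite [LHS]tracel_recover [RHS]tracel_recover.
apply: eq_bigr => j _; congr tens_lift; move: (hs j) => h.
have [S' _ S'K] := @antipode_bij k H.
(* The diagonal action of h_1 passes inside g by linearity, and 1 ⊗ S^-1(h_2) commutes with θ ⊗ 1,
   so only the composite of g with θ ⊗ 1 remains. *)
suff main (g : {linear X -> mtens (ind i M) N}) : tracel (mact2 h 1 (g x)) =
    \sw_(a, c <- comul h) \sw_(m, y <- tracel (g (a *: x))) tens_pure _ _ m (S' c *: y).
  by rewrite !main; apply: eq_tens_lift => a c; rewrite e.
have zb := mact2_act_balanced (g x).
rewrite -(bal_sw_pure zb) -(sw_antipode_inv_split S'K) (bal_sw_sw zb).
rewrite (tens_lift_comp _ _ tracelD).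
apply: eq_tens_lift => a c; rewrite (bal_sw_sw zb) -tracel_act linearZ.
congr tracel; rewrite /GRing.scale /= /mscale (tens_lift_comp _ _ (mact2D 1 (S' c))).
by apply: eq_tens_lift => a1 a2; rewrite (bal_sw_pure zb) mact2M mul1r.
Qed.
End Left.

Section Right.
Variables (M : lmodType K) (N : lmodType H).

Lemma tracer_balanced : balanced (@sratk k H N) (@slatk k H (ind i M))
  (fun y s => tens_pure (@sratk k H N) (@slatk k K M) y (ind_trace f s)).
Proof.
have hb := tens_pure_balanced (@sratk k H N) (@slatk k K M).
split=> [s y y'|y s s'|y c s] /=.
- by rewrite (balDl hb).
- by rewrite (ind_traceD fF) (balDr hb).
- by rewrite /slatk (incl_scalar i) (ind_traceZ fF) (balZ hb).
Qed.
Definition tracer (z : mtens N (ind i M)) : tensHK N M :=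
  \sw_(y, s <- z) tens_pure _ _ y (ind_trace f s).
Lemma tracerD : {morph tracer : x y / x + y}.
Proof. exact: tens_liftD tracer_balanced. Qed.
Lemma tracer_pure y s : tracer (mpure y s) = tens_pure _ _ y (ind_trace f s).
Proof. exact: tens_lift_pure tracer_balanced. Qed.

Lemma actr_balanced (b : H) : balanced (@sratk k H N) (@slatk k K M)
  (fun y m => tens_pure (@sratk k H N) (@slatk k K M) (b *: y) m).
Proof.
have hb := tens_pure_balanced (@sratk k H N) (@slatk k K M).
split=> [s y y'|s y y'|y c s] /=; rewrite ?scalerDr ?(balDl hb) ?(balDr hb) //.
by rewrite -(balZ hb) /sratk !scalerA scalA_comm.
Qed.
Lemma tracer_act b z : tracer (mact2 b 1 z) = \sw_(y, m <- tracer z) tens_pure _ _ (b *: y) m.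
Proof.
move: z; apply: mtens_ext => [||y s].
- exact: (morphD_comp tracerD (mact2D b 1)).
- exact: (morphD_comp (tens_liftD (actr_balanced b)) tracerD).
rewrite mact2_pure !tracer_pure scale1r.
by rewrite [RHS](tens_lift_pure _ _ (actr_balanced b)).
Qed.

Lemma unr_balanced (d : H) : balanced (@sratk k H N) (@slatk k K M)
  (fun y m => mpure y (ipure i d m)).
Proof.
split=> [s y y'|s y y'|y c s] /=; rewrite ?ipureDr ?mpureDl ?mpureDr //.
by rewrite /sratk /slatk mpureZ -ipureZ -(incl_scalar i) scalA_comm -ind_scale_pureE.
Qed.
Lemma tracer_recover z :
  z = \sum_j \sw_(y, m <- tracer (mact2 1 (hs j) z)) mpure y (ipure i (ds j) m).
Proof.
move: z; apply: mtens_ext => [//|x y|y s].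
  rewrite -big_split; apply: eq_bigr => j _.
  by rewrite (mact2D _ _ x y) (tracerD (mact2 _ _ x)) (tens_liftD (unr_balanced (ds j))).
rewrite [in LHS](ind_trace_recover fF s).
rewrite (big_morph (fun s => mpure y s) (fun s s' => mpureDr y s s')
  (bal0r (mpure_balanced _ _) y)).
apply: eq_bigr => j _; rewrite mact2_pure scale1r tracer_pure.
by rewrite [RHS](tens_lift_pure _ _ (unr_balanced (ds j))).
Qed.

(* Here 1 ⊗ h = (S(h_1) ⊗ 1) Δ(h_2). *)
Lemma mtens_sepr (X : lmodType H) (alpha beta : {linear X -> mtens N (ind i M)}) :
  (forall x, tracer (alpha x) = tracer (beta x)) -> alpha = beta.
Proof.
move=> e; apply: linear_ext => x; rewrite [LHS]tracer_recover [RHS]tracer_recover.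
apply: eq_bigr => j _; congr tens_lift; move: (hs j) => h.
suff main (g : {linear X -> mtens N (ind i M)}) : tracer (mact2 1 h (g x)) =
    \sw_(a, c <- comul h)
      \sw_(y, m <- tracer (g (c *: x))) tens_pure _ _ (antipode a *: y) m.
  by rewrite !main; apply: eq_tens_lift => a c; rewrite e.
have zb := mact2_act_balanced (g x).
rewrite -(bal_sw_pure zb) -sw_antipode_split (bal_sw_sw zb).
rewrite (tens_lift_comp _ _ tracerD).
apply: eq_tens_lift => a c; rewrite (bal_sw_sw zb) -tracer_act linearZ.
congr tracer; rewrite /GRing.scale /= /mscale (tens_lift_comp _ _ (mact2D (antipode a) 1)).
by apply: eq_tens_lift => c1 c2; rewrite (bal_sw_pure zb) mact2M mul1r.
Qed.
End Right.

Section TraceOplax.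
Variables M W : lmodType K.

Lemma ind_inr_balanced : balanced (@sratk k K M) (@slatk k K W)
  (fun m w => tens_pure (@sratk k K M) (@slatk k H (ind i W)) m (ind_in i w)).
Proof.
have hb := tens_pure_balanced (@sratk k K M) (@slatk k H (ind i W)).
split=> [w m m'|m w w'|m c w] /=; rewrite ?ind_inD ?(balDl hb) ?(balDr hb) //.
by rewrite (balZ hb) /slatk ind_inZ -incl_scalar.
Qed.
Definition ind_inr (z : mtens M W) : tensKH M (ind i W) :=
  \sw_(m, w <- z) tens_pure _ _ m (ind_in i w).
Lemma ind_inrD : {morph ind_inr : x y / x + y}.
Proof. exact: tens_liftD ind_inr_balanced. Qed.
Lemma ind_inr_pure m w : ind_inr (mpure m w) = tens_pure _ _ m (ind_in i w).
Proof. exact: tens_lift_pure ind_inr_balanced. Qed.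

(** At h ⊗ (m ⊗ w) the left side is f(h_1) m ⊗ (h_2 ⊗ w). Right colinearity turns it into f(h)_1 m ⊗
    (f(h)_2 ⊗ w), and f(h)_2 moves over to w. *)
Lemma tracel_oplax z : tracel (ind_oplax_map i M W z) = ind_inr (ind_trace f z).
Proof.
move: z; apply: ind_ext => [||h t].
- exact: (morphD_comp (@tracelD _ _) (linearD (ind_oplax_map i M W))).
- by move=> x y; rewrite (ind_traceD fF x y) ind_inrD.
move: t; apply: mtens_ext => [x y|x y|m w].
- rewrite (ipureDr i h x y) (linearD (ind_oplax_map i M W) (ipure i h x) (ipure i h y)).
  exact: tracelD.
- by rewrite (ipureDr i h x y) (ind_traceD fF (ipure i h x)) ind_inrD.
have hb := tens_pure_balanced (@sratk k K M) (@slatk k H (ind i W)).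
have Fb : balanced (fun (c : K) (e : k) => e *: c) (fun (e : k) (c : H) => e *: c)
    (fun c e => tens_pure (@sratk k K M) (@slatk k H (ind i W)) (c *: m) (ipure i e w)).
  split=> [e c c'|c e e'|c l e] /=.
  - by rewrite scalerDl (balDl hb).
  - by rewrite ipureDl (balDr hb).
  - rewrite -(mulr_algl l c) -scalerA (balZ hb).
    by rewrite /slatk ind_scale_pureE mulr_algl.
rewrite ind_oplax_pure (tens_lift_comp _ _ (@tracelD _ _)) (ind_trace_pure fF).
rewrite mtens_scale_pure (tens_lift_comp _ _ ind_inrD).
have /(congr1 (tens_lift (fun c e => tens_pure (@sratk k K M) (@slatk k H (ind i W))
  (c *: m) (ipure i e w)))) := fC h.
rewrite !(bal_sw_sw Fb) => e; apply: etrans (etrans e _).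
  apply: eq_tens_lift => a b.
  by rewrite tracel_pure (ind_trace_pure fF) [RHS](bal_sw_pure Fb).
apply: eq_tens_lift => c d; rewrite [LHS](bal_sw_pure Fb) ind_inr_pure.
by rewrite /ind_in -ipureZ mul1r.
Qed.

Variable b : H.
Hypothesis fB : forall x,
  \sw_(a, c <- comul x) vpure a (f c) = \sw_(c, d <- comul (f x)) vpure (b * i c) d.

Lemma ind_inl_balanced : balanced (@sratk k K M) (@slatk k K W)
  (fun m w => tens_pure (@sratk k H (ind i M)) (@slatk k K W) (ipure i b m) w).
Proof.
have hb := tens_pure_balanced (@sratk k H (ind i M)) (@slatk k K W).
split=> [w m m'|m w w'|m c w] /=; rewrite ?ipureDr ?(balDl hb) ?(balDr hb) //.
by rewrite -(balZ hb) /sratk -ipureZ -(incl_scalar i) scalA_comm -ind_scale_pureE.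
Qed.
Definition ind_inl (z : mtens M W) : tensHK (ind i M) W :=
  \sw_(m, w <- z) tens_pure _ _ (ipure i b m) w.
Lemma ind_inlD : {morph ind_inl : x y / x + y}.
Proof. exact: tens_liftD ind_inl_balanced. Qed.
Lemma ind_inl_pure m w : ind_inl (mpure m w) = tens_pure _ _ (ipure i b m) w.
Proof. exact: tens_lift_pure ind_inl_balanced. Qed.

(** At h ⊗ (m ⊗ w), (h_1 ⊗ m) ⊗ f(h_2) w becomes (b f(h)_1 ⊗ m) ⊗ f(h)_2 w by [fB], and f(h)_1 moves
    over to m. *)
Lemma tracer_oplax z : tracer (ind_oplax_map i M W z) = ind_inl (ind_trace f z).
Proof.
move: z; apply: ind_ext => [||h t].
- exact: (morphD_comp (@tracerD _ _) (linearD (ind_oplax_map i M W))).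
- by move=> x y; rewrite (ind_traceD fF x y) ind_inlD.
move: t; apply: mtens_ext => [x y|x y|m w].
- rewrite (ipureDr i h x y) (linearD (ind_oplax_map i M W) (ipure i h x) (ipure i h y)).
  exact: tracerD.
- by rewrite (ipureDr i h x y) (ind_traceD fF (ipure i h x)) ind_inlD.
have hb := tens_pure_balanced (@sratk k H (ind i M)) (@slatk k K W).
have Fb : balanced (fun (e : H) (c : k) => c *: e) (fun (c : k) (d : K) => c *: d)
    (fun e d => tens_pure (@sratk k H (ind i M)) (@slatk k K W) (ipure i e m) (d *: w)).
  split=> [d e e'|e d d'|e l d] /=.
  - by rewrite ipureDl (balDl hb).
  - by rewrite scalerDl (balDr hb).
  - rewrite -(mulr_algl l d) -[(l%:A * d) *: w]scalerA -(balZ hb).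
    by rewrite /sratk ind_scale_pureE mulr_algl.
rewrite ind_oplax_pure (tens_lift_comp _ _ (@tracerD _ _)) (ind_trace_pure fF).
rewrite mtens_scale_pure (tens_lift_comp _ _ ind_inlD).
have /(congr1 (tens_lift (fun e d => tens_pure (@sratk k H (ind i M)) (@slatk k K W)
  (ipure i e m) (d *: w)))) := fB h.
rewrite !(bal_sw_sw Fb) => e; apply: etrans (etrans e _).
  apply: eq_tens_lift => a c.
  by rewrite tracer_pure (ind_trace_pure fF) [RHS](bal_sw_pure Fb).
apply: eq_tens_lift => c d; rewrite [LHS](bal_sw_pure Fb) ind_inl_pure.
by rewrite ipureZ.
Qed.
End TraceOplax.
End FrobeniusMonoidal.

Section FrobeniusConditions.
Variables (k : fieldType) (K H : hopfAlgType k) (i : hopf_extension K H).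
Variables (n : nat) (f : H -> K) (hs ds : 'I_n -> H).
Hypothesis fF : frobenius_system i f hs ds.
Hypothesis fC : forall x,
  \sw_(a, b <- comul x) vpure (f a) b = \sw_(c, d <- comul (f x)) vpure c (i d).

(** After θ ⊗ 1, both sides at s ⊗ t are θ(s) ⊗ (1 ⊗ η)θ(t), up to the associator: the left by θ lax
    = θ ⊗ θ and [tracel_oplax] on t, the right by [tracel_oplax] and then θ lax = θ ⊗ θ. *)
Lemma ind_frobenius_l (V U W : lmodType K) :
  lcomp (lcomp (mmap (ind_lax_map fF V U) idfun) (massocV (ind i V) (ind i U) (ind i W)))
    (mmap idfun (ind_oplax_map i U W)) =
  lcomp (lcomp (ind_oplax_map i (mtens V U) W) (imap i (massocV V U W)))
    (ind_lax_map fF V (mtens U W)).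
Proof.
apply: (mtens_sepl fF) => z; rewrite !lcompE (tracel_oplax fF fC).
rewrite (ind_trace_imap fF) ind_trace_lax; move: z; apply: mtens_ext => [x y|x y|s t].
- pose g := lcomp (lcomp (mmap (ind_lax_map fF V U) idfun)
    (massocV (ind i V) (ind i U) (ind i W))) (mmap idfun (ind_oplax_map i U W)).
  have := linearD g x y; rewrite !lcompE => ->; exact: (tracelD fF).
- rewrite (trace2D fF x y) (linearD (massocV V U W) (trace2 f x)).
  exact: ind_inrD.
rewrite mmap_pure (trace2_pure fF).
have hb := tens_pure_balanced (@sratk k K (mtens V U)) (@slatk k H (ind i W)).
have Jb : balanced (@sratk k K U) (@slatk k H (ind i W))
    (fun m y => tens_pure (@sratk k K (mtens V U)) (@slatk k H (ind i W))
      (mpure (ind_trace f s) m) y).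
  split=> [y m m'|m y y'|m c y] /=; rewrite ?mpureDr ?(balDl hb) ?(balDr hb) //.
  by rewrite -(balZ hb) /sratk mtens_scalk mpureZ.
transitivity (\sw_(m, y <- tracel f (ind_oplax_map i U W t))
    tens_pure (@sratk k K (mtens V U)) (@slatk k H (ind i W)) (mpure (ind_trace f s) m) y).
  move: (ind_oplax_map i U W t); apply: mtens_ext => [x y|x y|u w].
  - rewrite (mpureDr s x y).
    rewrite (linearD (massocV (ind i V) (ind i U) (ind i W)) (mpure s x) (mpure s y)).
    rewrite (linearD (mmap (ind_lax_map fF V U) idfun) (massocV _ _ _ (mpure s x))).
    exact: (tracelD fF).
  - by rewrite (tracelD fF x y) (tens_liftD Jb).
  rewrite massocV_pure mmap_pure (tracel_pure fF) ind_trace_lax (trace2_pure fF).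
  by rewrite (tracel_pure fF) [RHS](tens_lift_pure _ _ Jb).
rewrite (tracel_oplax fF fC); move: (ind_trace f t); apply: mtens_ext => [x y|x y|u w].
- by rewrite (ind_inrD i x y) (tens_liftD Jb).
- rewrite (mpureDr (ind_trace f s) x y).
  rewrite (linearD (massocV V U W) (mpure _ x) (mpure _ y)).
  exact: ind_inrD.
by rewrite massocV_pure !ind_inr_pure [LHS](tens_lift_pure _ _ Jb).
Qed.

(** The mirror argument with 1 ⊗ θ; the element b of [colinear_left] enters both sides in the same
    way. *)
Lemma ind_frobenius_r (V U W : lmodType K) :
  lcomp (lcomp (mmap idfun (ind_lax_map fF U W)) (massoc (ind i V) (ind i U) (ind i W)))
    (mmap (ind_oplax_map i V U) idfun) =
  lcomp (lcomp (ind_oplax_map i V (mtens U W)) (imap i (massoc V U W)))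
    (ind_lax_map fF (mtens V U) W).
Proof.
have [b fB] := colinear_left fF fC.
apply: (mtens_sepr fF) => z; rewrite !lcompE (tracer_oplax fF fB).
rewrite (ind_trace_imap fF) ind_trace_lax; move: z; apply: mtens_ext => [x y|x y|t s].
- pose g := lcomp (lcomp (mmap idfun (ind_lax_map fF U W))
    (massoc (ind i V) (ind i U) (ind i W))) (mmap (ind_oplax_map i V U) idfun).
  have := linearD g x y; rewrite !lcompE => ->; exact: (tracerD fF).
- rewrite (trace2D fF x y) (linearD (massoc V U W) (trace2 f x)).
  exact: ind_inlD.
rewrite mmap_pure (trace2_pure fF).
have hb := tens_pure_balanced (@sratk k H (ind i V)) (@slatk k K (mtens U W)).
have Jb : balanced (@sratk k H (ind i V)) (@slatk k K U)
    (fun y m => tens_pure (@sratk k H (ind i V)) (@slatk k K (mtens U W))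
      y (mpure m (ind_trace f s))).
  split=> [m y y'|y m m'|y c m] /=; rewrite ?mpureDl ?(balDl hb) ?(balDr hb) //.
  by rewrite (balZ hb) /slatk mtens_scalk.
transitivity (\sw_(y, m <- tracer f (ind_oplax_map i V U t))
    tens_pure (@sratk k H (ind i V)) (@slatk k K (mtens U W)) y (mpure m (ind_trace f s))).
  move: (ind_oplax_map i V U t); apply: mtens_ext => [x y|x y|v u].
  - rewrite (mpureDl x y s).
    rewrite (linearD (massoc (ind i V) (ind i U) (ind i W)) (mpure x s) (mpure y s)).
    rewrite (linearD (mmap idfun (ind_lax_map fF U W)) (massoc _ _ _ (mpure x s))).
    exact: (tracerD fF).
  - by rewrite (tracerD fF x y) (tens_liftD Jb).
  rewrite massoc_pure mmap_pure (tracer_pure fF) ind_trace_lax (trace2_pure fF).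
  by rewrite (tracer_pure fF) [RHS](tens_lift_pure _ _ Jb).
rewrite (tracer_oplax fF fB); move: (ind_trace f t); apply: mtens_ext => [x y|x y|v u].
- by rewrite (ind_inlD i b x y) (tens_liftD Jb).
- rewrite (mpureDl x y (ind_trace f s)).
  rewrite (linearD (massoc V U W) (mpure x _) (mpure y _)).
  exact: ind_inlD.
by rewrite massoc_pure !ind_inl_pure [LHS](tens_lift_pure _ _ Jb).
Qed.

Lemma ind_frobenius_structures :
  frobenius_monoidal (ind_lax_structure fF) (ind_oplax_structure i).
Proof. by move=> V U W; split; [exact: ind_frobenius_l | exact: ind_frobenius_r]. Qed.
End FrobeniusConditions.

(** * Frobenius extensions and dual bases *)

Section Systems.
Variables (k : fieldType) (K H : hopfAlgType k) (i : hopf_extension K H).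

Lemma resmod_linear_lin (t : {linear resmod i -> K^o}) : @lin k H K t.
Proof.
move=> c x y.
have -> : c *: x = (c%:A : K) *: (x : resmod i).
  by rewrite resmod_scaleE -(incl_scalar i) mulr_algl.
by rewrite [LHS]linearP; congr (_ + _); exact: mulr_algl.
Qed.

(** Projectivity splits the surjection K^n -> H given by generators hs_j. The coordinates of the
    splitting are left K-linear, hence of the form t((-) ds_j), which is the left dual basis
    identity. *)
Lemma frobenius_system_exists : frobenius_extension i ->
  exists n (t : H -> K) (hs ds : 'I_n -> H), frobenius_system i t hs ds.
Proof.
move=> [[s sP] proj [t [tMr tB]]].
have tMl a h : t (i a * h) = a * t h.
    by rewrite -[LHS]/(t (a *: (h : resmod i))) linearZ.
have tl := resmod_linear_lin t.
pose p_fun (r : 'rV[K]_(size s)) : resmod i := \sum_j r 0 j *: s`_j.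
have p_lin : linear p_fun.
  move=> a r r'; rewrite /p_fun scaler_sumr -big_split; apply: eq_bigr => j _.
  by rewrite !mxE scalerDl scalerA.
have [|g gK] := proj _ _ (mklin p_lin) (idfun : {linear resmod i -> resmod i}).
  move=> y; have [c ->] := sP y; exists (\row_j c j).
  by apply: eq_bigr => j _; rewrite mxE.
have /fin_all_exists[d dP] (j : 'I_(size s)) :
    exists d : H, forall x : H, g x 0 j = t (x * d).
  have c_lin : linear (fun x => g x 0 j : K^o) by move=> a x y; rewrite linearP !mxE.
  by have [d [dP _]] := tB (mklin c_lin); exists d.
pose h (j : 'I_(size s)) : H := s`_j.
have dual_l (x : H) : x = \sum_j i (t (x * d j)) * h j.
  rewrite -[LHS](gK x); apply: eq_bigr => j _.
  by rewrite -dP resmod_scaleE.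
exists (size s), t, h, d; split=> // x.
(* The right identity follows by uniqueness: x and Σ ds_j t(hs_j x) represent the same functional
   t((-)x), as expanding y by the left identity shows. *)
have x_lin : linear (fun y : resmod i => t ((y : H) * x) : K^o).
  move=> a y z; rewrite resmod_scaleE mulrDl (linD tl) -mulrA tMl.
  by [].
have [z [_ zU]] := tB (mklin x_lin).
transitivity z; first by apply: esym; apply: zU.
apply: zU => y /=.
rewrite [in LHS](dual_l y) mulr_suml mulr_sumr !(lin_sum _ _ tl); apply: eq_bigr => j _.
by rewrite -mulrA tMl mulrA tMr.
Qed.

Variables (n : nat) (f : H -> K) (hs ds : 'I_n -> H).
Hypothesis fF : frobenius_system i f hs ds.
Let fl := frob_lin fF.

Fact frobenius_system_linear : linear (f : resmod i -> K^o).
Proof. by move=> a x y; rewrite (linD fl) resmod_scaleE (frobMl fF). Qed.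
Definition frobenius_system_map : {linear resmod i -> K^o} := mklin frobenius_system_linear.

Lemma frobenius_system_morphism : frobenius_morphism frobenius_system_map.
Proof.
split=> [h a|g]; first exact: frobMr fF h a.
have gl := resmod_linear_lin g.
(* Left linearity of g gives g(x) = Σ f(x ds_j) g(hs_j), and right linearity of f moves g(hs_j)
   inside f. *)
exists (\sum_j ds j * i (g (hs j))); split=> [x|h hP].
  rewrite [in LHS](frob_dual_l fF x) (lin_sum _ _ gl) mulr_sumr.
  rewrite [RHS](lin_sum _ _ fl); apply: eq_bigr => j _.
  by rewrite mulrA (frobMr fF) -[LHS]/(g (_ *: (hs j : resmod i))) linearZ.
rewrite [RHS](frob_dual_r fF); apply: eq_bigr => j _.
by rewrite hP.
Qed.
End Systems.

Theorem theorem1 (k : fieldType) (K H : hopfAlgType k) (i : hopf_extension K H) :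
  fin_generated (H : lmodType k) \/ pointed H \/ right_integral_type i ->
  frobenius_extension i ->
  ind_frobenius_monoidal i.
Proof.
move=> _ /frobenius_system_exists[n [t [hs [ds tF]]]].
have [R hR] := twist_exists tF.
have fF := normalized_frobenius_system tF hR.
have fC := normalized_colinear tF hR.
(* The Frobenius morphism chosen is the colinear one, t(u -), so the hs_j carry the inverse of u. *)
exists (frobenius_system_map fF), n, (fun j => twist_inv R * hs j), ds.
exists (ind_lax_structure fF), (ind_oplax_structure i); split.
- exact: frobenius_system_morphism.
- by move=> h; split; [exact: (frob_dual_l fF) | exact: (frob_dual_r fF)].
- split=> [V U h g v u|]; last first.
    rewrite [LHS]coextE; apply: eq_bigr => j _; congr (ipure _ _ _).
    by rewrite /unit_id munit_scaleE mulr1.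
  rewrite [LHS]coextE; apply: eq_bigr => j _; congr (ipure _ _ _).
  rewrite mtens_scale_pure (tens_lift_comp _ _ (@trace2D _ _ _ _ _ _ _ _ fF _ _)).
  apply: eq_tens_lift => a b.
  by rewrite (trace2_pure fF) !ind_scale_pureE !(ind_trace_pure fF).
- split=> [V U h v u|h]; first exact: ind_oplax_pure.
  by rewrite [LHS]ext_pure munit_scaleE mulr1.
- exact: ind_frobenius_structures.
Qed.
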